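(* Let $\overline\nu=(\nu_2,\dots,\nu_r)$ be a partition of $d$. Then ${\sf g}(\rho_k,\rho_k,(n_k-d,\overline\nu))>0$ for all $k\ge t(\overline\nu)$, with the possible exception of at most $$2d-\frac{1+\sqrt{1+8(\nu_2+d)}}{2}$$ values of $k$.
   Context: ${\sf g}(\lambda,\mu,\nu)=\langle\chi^\lambda\otimes\chi^\mu,\chi^\nu\rangle$ is the Kronecker coefficient, where $\chi^\lambda$ is the irreducible character of the symmetric group ${\sf S}_n$ associated to the partition $\lambda$ of $n$, $\otimes$ is the Kronecker product of characters and $\langle\cdot,\cdot\rangle$ is the scalar product of complex characters. For a positive integer $k$, $\rho_k=(k,k-1,\dots,2,1)$ is the staircase partition, of size $n_k=\binom{k+1}{2}$; $k$ ranges over positive integers. For a partition $\overline\nu=(\nu_2,\dots,\nu_r)$ of $d$ (so $\nu_2$ is its largest part), $(n_k-d,\overline\nu)=(n_k-d,\nu_2,\dots,\nu_r)$. The number $t(\overline\nu)$ is the smallest integer greater than or equal to $\frac{-1+\sqrt{1+8(\nu_2+d)}}{2}$; equivalently, $(n_k-d,\overline\nu)$ is a partition of $n_k$ if and only if $k\ge t(\overline\nu)$.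
   Formalization: For d ≤ 1 the stated bound on the number of exceptional values of k is negative, which no count can satisfy; there it is replaced by 0, i.e. no exceptions; for d ≥ 2 the bound is as stated. *)

(* Defs.v *)
From HB Require Import structures.
From mathcomp Require Import all_boot all_order all_fingroup all_algebra.
From mathcomp Require Import all_solvable all_field all_character.

Set Implicit Arguments.
Unset Strict Implicit.
Unset Printing Implicit Defensive.

Import GroupScope Order.TTheory GRing.Theory Num.Theory.
Local Open Scope ring_scope.

Definition is_partition (n : nat) (l : seq nat) : bool :=
  [&& sorted geq l, all (leq 1) l & sumn l == n].

(* The canonical tableau of shape l places 0, ..., n-1 in the diagram of l row *)
(* by row: the entry i lies in row [reshape_index l i] and in column           *)
(* [reshape_offset l i].                                                       *)
Definition row_stab (n : nat) (l : seq nat) : {set 'S_n} :=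
  [set s : 'S_n | [forall i : 'I_n,
     reshape_index l (s i) == reshape_index l i]].

Definition col_stab (n : nat) (l : seq nat) : {set 'S_n} :=
  [set s : 'S_n | [forall i : 'I_n,
     reshape_offset l (s i) == reshape_offset l i]].

(* c_l = (\sum_p p) (\sum_q sgn(q) q) in the group algebra of 'S_n, written in *)
(* the basis of group elements on which [regular_repr] acts.                   *)
Definition young_symmetrizer (n : nat) (l : seq nat) :
    'rV[algC]_#|[set: 'S_n]%G| :=
  \sum_(p in row_stab n l) \sum_(q in col_stab n l)
    (-1) ^+ q *: delta_mx 0 (gring_index [set: 'S_n]%G (p * q)%g).

(* The ideal of the group algebra generated by c_l: this is the Specht module  *)
(* of the partition l.                                                         *)
Definition specht_mx (n : nat) (l : seq nat) :
    'M[algC]_#|[set: 'S_n]%G| :=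
  cyclic_mx (regular_repr algC [set: 'S_n]%G) (young_symmetrizer n l).

Definition specht_repr (n : nat) (l : seq nat) :
    mx_representation algC [set: 'S_n]%G (\rank (specht_mx n l)) :=
  submod_repr (cyclic_mx_module (regular_repr algC [set: 'S_n]%G)
                 (young_symmetrizer n l)).

Definition sym_char (n : nat) (l : seq nat) : 'CF([set: 'S_n]%G) :=
  cfRepr (specht_repr n l).

(* The Kronecker product of characters is the pointwise product in 'CF(G). *)
Definition kronecker (n : nat) (lam mu nu : seq nat) : algC :=
  '[sym_char n lam * sym_char n mu, sym_char n nu].

Definition staircase (k : nat) : seq nat := rev (iota 1 k).

(* [nu] stands for (nu_2, ..., nu_r), so its largest part nu_2 is [head 0 nu], *)
(* which is 0 when nu is the empty partition.                                  *)
Definition tmin (d : nat) (nu : seq nat) : int :=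
  Num.ceil ((-1 + sqrtC (1 + 8 * (head 0%N nu + d)%:R)) / 2 : algC).

(* This is negative when d <= 1; an upper bound on a number of exceptional     *)
(* values is then to be read as 0, i.e. as [Num.max 0 (exception_bound d nu)]. *)
Definition exception_bound (d : nat) (nu : seq nat) : algC :=
  2 * d%:R - (1 + sqrtC (1 + 8 * (head 0%N nu + d)%:R)) / 2.

(* Main.v *)
Require Import Defs.
From HB Require Import structures.
From mathcomp Require Import all_boot all_order all_fingroup all_algebra.
From mathcomp Require Import all_solvable all_field all_character.
From mathcomp Require Import zify ring.

(** Let [V] be the Specht module of the staircase [rho_k], generated by [lam],
    and let [c = a_mu b_mu] be the Young symmetrizer of [mu = (n_k - d, nu)].
    The Kronecker coefficient is positive as soon as [c] acts as a nonzero
    operator on [V (x) V]: if [w c <> 0], then [x |-> w x] is a nonzero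
    homomorphism on the right ideal generated by [c], which is the module of
    [mu] ([kronecker_gt0]).  This happens for every [k > d]
    ([kronecker_staircase_gt0]), so that only the integers from [t(nu)] to [d]
    can be exceptional.  There are at most [d + 1 - t(nu)] of them, which is
    within the bound when [d >= 2], and none when [d <= 1].

    To find a vector that [c] does not kill, take the corners of [rho_k] in
    rows [1, ..., d] (rows and columns are numbered from 0), let [al] be the
    set of all other points, and use a tableau of shape [mu] whose first row
    is [al].  Call a vector [w] of full depth if it is invariant under the
    permutations of [al] and if symmetrizing it over [al] together with any
    one corner gives 0.

    - The factors of the column antisymmetrizer that involve [al] do not kill
      any nonzero vector of full depth ([col_antisymmetrizer_neq0]): a product
      of [r] disjoint transpositions between [al] and the corners acts, after
      averaging over [al], as [(-1)^r] times a positive multiple of a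
      symmetrizer ([swaps_sym]).  These signs cancel those of the
      antisymmetrizer, and the result is positive definite.

    - A vector of full depth is the average over [al] of [lam (x) v], where
      [v] is a sum of vectors symmetric under the rows of tableaux in which
      each chosen corner shares its row with the point above it in its column
      ([moved_kill]).  The transposition of these two points fixes such a
      vector and changes the sign of [lam], so averaging over a set that
      contains both gives 0.  Such a tableau needs one corner more than the [d]
      chosen ones: this is where [d < k] enters.

    - The vector is nonzero, and the permutations of the corners move it to
      linearly independent vectors ([average_ev]), because a coefficient of
      the first factor detects the identity.  What remains to be seen is that
      [v b' a' <> 0] for the column and row groups of [al]; a Garnir relation
      reduces this to [lam a b' a' <> 0] ([witness_sandwich]), which holds
      because the trace of [a b a b' a'] is a positive multiple of a squared
      norm ([sandwich_neq0]).  Here [a] and [b] are the row and column sums of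
      the whole staircase, and [a'] and [b'] those of [al]. *)

Set Implicit Arguments.
Unset Strict Implicit.
Unset Printing Implicit Defensive.

Import GroupScope Order.TTheory GRing.Theory Num.Theory.
Local Open Scope ring_scope.

(** * Kronecker products of matrices *)

Section Kronecker.

Variable R : comNzRingType.

(** Rows and columns are indexed by pairs through [mxvec_index], which turns
    sums over the indices of the product into double sums. *)
Definition kron m1 n1 m2 n2 (A : 'M[R]_(m1, n1)) (B : 'M[R]_(m2, n2)) :
    'M[R]_(m1 * m2, n1 * n2) :=
  \matrix_i mxvec (\matrix_(j1, j2)
    let p := enum_val (cast_ord (esym (mxvec_cast m1 m2)) i) in
    A p.1 j1 * B p.2 j2).

Lemma kronE m1 n1 m2 n2 (A : 'M[R]_(m1, n1)) (B : 'M[R]_(m2, n2))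
    i1 i2 j1 j2 :
  kron A B (mxvec_index i1 i2) (mxvec_index j1 j2) = A i1 j1 * B i2 j2.
Proof.
by rewrite mxE mxvecE mxE /mxvec_index cast_ordK enum_rankK.
Qed.

Lemma sum_mxvec_index (V : nmodType) m n (F : 'I_(m * n) -> V) :
  \sum_i F i = \sum_(i < m) \sum_(j < n) F (mxvec_index i j).
Proof.
rewrite pair_bigA (reindex (uncurry (@mxvec_index m n))) /=; last first.
  exact: curry_mxvec_bij.
by apply: eq_bigr => -[].
Qed.

Lemma kronP m1 n1 m2 n2 (X Y : 'M[R]_(m1 * m2, n1 * n2)) :
  (forall i1 i2 j1 j2, X (mxvec_index i1 i2) (mxvec_index j1 j2)
     = Y (mxvec_index i1 i2) (mxvec_index j1 j2)) -> X = Y.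
Proof.
by move=> eXY; apply/matrixP => i j; case/mxvec_indexP: i => i1 i2;
   case/mxvec_indexP: j => j1 j2.
Qed.

Lemma kronM m1 n1 p1 m2 n2 p2 (A : 'M[R]_(m1, n1)) (A' : 'M[R]_(n1, p1))
    (B : 'M[R]_(m2, n2)) (B' : 'M[R]_(n2, p2)) :
  kron A B *m kron A' B' = kron (A *m A') (B *m B').
Proof.
apply/kronP => i1 i2 j1 j2; rewrite kronE [LHS]mxE sum_mxvec_index.
rewrite !mxE big_distrlr /=.
apply: eq_bigr => a _; apply: eq_bigr => b _; rewrite !kronE.
by rewrite mulrACA.
Qed.

Lemma kronDl m1 n1 m2 n2 (A A' : 'M[R]_(m1, n1)) (B : 'M[R]_(m2, n2)) :
  kron (A + A') B = kron A B + kron A' B.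
Proof. by apply/kronP => *; rewrite [RHS]mxE !kronE mxE mulrDl. Qed.

Lemma kronDr m1 n1 m2 n2 (A : 'M[R]_(m1, n1)) (B B' : 'M[R]_(m2, n2)) :
  kron A (B + B') = kron A B + kron A B'.
Proof. by apply/kronP => *; rewrite [RHS]mxE !kronE mxE mulrDr. Qed.

Lemma kronZl m1 n1 m2 n2 a (A : 'M[R]_(m1, n1)) (B : 'M[R]_(m2, n2)) :
  kron (a *: A) B = a *: kron A B.
Proof. by apply/kronP => *; rewrite [RHS]mxE !kronE mxE mulrA. Qed.

Lemma kronZr m1 n1 m2 n2 a (A : 'M[R]_(m1, n1)) (B : 'M[R]_(m2, n2)) :
  kron A (a *: B) = a *: kron A B.
Proof. by apply/kronP => *; rewrite [RHS]mxE !kronE mxE mulrCA. Qed.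

Lemma kron0l m1 n1 m2 n2 (B : 'M[R]_(m2, n2)) :
  kron (0 : 'M_(m1, n1)) B = 0.
Proof. by apply/kronP => *; rewrite kronE !mxE mul0r. Qed.

Lemma kron0r m1 n1 m2 n2 (A : 'M[R]_(m1, n1)) :
  kron A (0 : 'M_(m2, n2)) = 0.
Proof. by apply/kronP => *; rewrite kronE !mxE mulr0. Qed.

Lemma kron_suml (I : Type) (s : seq I) (P : pred I) m1 n1 m2 n2
    (F : I -> 'M[R]_(m1, n1)) (B : 'M[R]_(m2, n2)) :
  kron (\sum_(i <- s | P i) F i) B = \sum_(i <- s | P i) kron (F i) B.
Proof. by elim/big_rec2: _ => [|i x y _ <-]; rewrite ?kron0l ?kronDl. Qed.

Lemma kron_sumr (I : Type) (s : seq I) (P : pred I) m1 n1 m2 n2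
    (A : 'M[R]_(m1, n1)) (F : I -> 'M[R]_(m2, n2)) :
  kron A (\sum_(i <- s | P i) F i) = \sum_(i <- s | P i) kron A (F i).
Proof. by elim/big_rec2: _ => [|i x y _ <-]; rewrite ?kron0r ?kronDr. Qed.

Lemma kron_tr m1 n1 m2 n2 (A : 'M[R]_(m1, n1)) (B : 'M[R]_(m2, n2)) :
  (kron A B)^T = kron A^T B^T.
Proof. by apply/kronP => *; rewrite [LHS]mxE !kronE !mxE. Qed.

Lemma mxvec_index_eq m n (i1 j1 : 'I_m) (i2 j2 : 'I_n) :
  (mxvec_index i1 i2 == mxvec_index j1 j2) = (i1 == j1) && (i2 == j2).
Proof.
by rewrite /mxvec_index (inj_eq (@cast_ord_inj _ _ _)) (inj_eq enum_rank_inj).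
Qed.

Lemma kron1 m n : kron (1%:M : 'M[R]_m) (1%:M : 'M[R]_n) = 1%:M.
Proof.
by apply/kronP => *; rewrite kronE !mxE mxvec_index_eq -natrM mulnb.
Qed.

Lemma mxtrace_kron m n (A : 'M[R]_m) (B : 'M[R]_n) :
  \tr (kron A B) = \tr A * \tr B.
Proof.
rewrite /mxtrace sum_mxvec_index big_distrlr /=.
by apply: eq_bigr => i _; apply: eq_bigr => j _; rewrite kronE.
Qed.

Lemma map_kron (f : {rmorphism R -> R}) m1 n1 m2 n2
    (A : 'M[R]_(m1, n1)) (B : 'M[R]_(m2, n2)) :
  map_mx f (kron A B) = kron (map_mx f A) (map_mx f B).
Proof. by apply/kronP => *; rewrite [LHS]mxE !kronE !mxE rmorphM. Qed.

End Kronecker.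

(** * Multiplicities as ranks of averaging projections *)

Section CharacterProducts.

(** In a full rank factorization [P = C R] of an idempotent, [R C] is the
    identity matrix, whose size is the rank. *)
Lemma mxtrace_idempotent (F : fieldType) n (P : 'M[F]_n) :
  P *m P = P -> \tr P = (\rank P)%:R.
Proof.
move=> idP; rewrite -[in LHS](mulmx_base P) mxtrace_mulC.
suff -> : row_base P *m col_base P = 1%:M by rewrite mxtrace1.
apply: (row_free_inj (row_base_free P)).
apply: (row_full_inj (col_base_full P)).
rewrite mul1mx mulmx_base -mulmxA mulmx_base mulmxA mulmx_base.
exact: idP.
Qed.

Lemma sum_group_mull (V : nmodType) (gT : finGroupType) (G : {group gT}) 
    (F : gT -> V) x :
  x \in G -> \sum_(y in G) F (x * y)%g = \sum_(y in G) F y.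
Proof.
move=> Gx; rewrite [RHS](reindex_inj (mulgI x)) /=.
by apply: eq_bigl => y; rewrite groupMl.
Qed.

Lemma sum_group_mulr (V : nmodType) (gT : finGroupType) (G : {group gT}) 
    (F : gT -> V) x :
  x \in G -> \sum_(y in G) F (y * x)%g = \sum_(y in G) F y.
Proof.
move=> Gx; rewrite [RHS](reindex_inj (mulIg x)) /=.
by apply: eq_bigl => y; rewrite groupMr.
Qed.

Lemma average_idempotent (gT : finGroupType) (G : {group gT}) n
    (rG : gT -> 'M[algC]_n) :
  {in G &, {morph rG : x y / (x * y)%g >-> x *m y}} ->
  let P := #|G|%:R^-1 *: \sum_(x in G) rG x in P *m P = P.
Proof.
move=> rM /=; rewrite -scalemxAl -scalemxAr mulmx_suml; congr (_ *: _).
rewrite (eq_bigr (fun=> \sum_(y in G) rG y)) => [|x Gx].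
  by rewrite sumr_const -scaler_nat scalerA mulVf ?scale1r ?neq0CG.
rewrite mulmx_sumr -[RHS](sum_group_mull _ Gx).
by apply: eq_bigr => y Gy; rewrite rM.
Qed.

Lemma row_regular_mx (gT : finGroupType) (G : {group gT}) x
    (c : 'rV[algC]_#|G|) y : x \in G -> y \in G ->
  (c *m regular_repr algC G x) 0 (gring_index G y)
    = c 0 (gring_index G (y * x^-1)).
Proof.
move=> Gx Gy; rewrite mxE (bigD1 (gring_index G (y * x^-1))) //=.
rewrite big1 => [|i ne_i].
  by rewrite addr0 !mxE gring_indexK ?groupM ?groupV // mulgKV !eqxx mulr1.
rewrite !mxE eqxx /=; case: eqP => [e|]; last by rewrite mulr0.
case/eqP: ne_i; move/(congr1 enum_val): e.
rewrite !gring_indexK ?groupM ?enum_valP // => ->.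
by rewrite mulgK gring_valK.
Qed.

(** The Kronecker coefficient is the trace, hence the rank, of the averaging
    projection onto the invariants of [V_lam (x) V_mu (x) V_nu^*].  Contracting
    its last factor with the generator [c] of [V_nu] and with the coefficient
    at the identity leaves the action of [c] on [v (x) v']. *)
Lemma kronecker_gt0 n lam mu nu (v v' : 'rV[algC]_#|[set: 'S_n]%G|) :
  (v <= specht_mx n lam)%MS -> (v' <= specht_mx n mu)%MS ->
  let aG := regular_repr algC [set: 'S_n]%G in
  kron v v' *m (\sum_g young_symmetrizer n nu 0 (gring_index [set: 'S_n]%G g)
                   *: kron (aG g) (aG g)) != 0 ->
  0 < kronecker n lam mu nu.
Proof.
set G := [set: 'S_n]%G => Uv Uv' aG; set c := young_symmetrizer n nu.
apply: contra_neqT => kron_le0.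
pose rl := specht_repr n lam; pose rm := specht_repr n mu.
pose rn := specht_repr n nu.
pose r g := kron (kron (rl g) (rm g)) (rn g^-1%g)^T.
pose P := #|G|%:R^-1 *: \sum_(g in G) r g.
have idP : P *m P = P.
  apply: average_idempotent => x y Gx Gy; rewrite /r !kronM -trmx_mul.
  by rewrite invMg !repr_mxM ?groupV.
have trP : kronecker n lam mu nu = \tr P.
  rewrite /kronecker cfdotE mxtraceZ raddf_sum /=; congr (_ * _).
  apply: eq_bigr => g Gg; rewrite !mxtrace_kron mxtrace_tr cfunE.
  rewrite -char_inv ?cfRepr_char // /sym_char !cfunE.
  by rewrite groupV Gg !mulr1n.
have {trP idP} P0 : P = 0.
  apply/eqP; rewrite -mxrank_eq0 -leqn0 leqNgt; apply: contra kron_le0.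
  by rewrite trP mxtrace_idempotent // ltr0n.
have {P0} r0 : \sum_(g in G) r g = 0.
  apply/eqP; move/eqP: P0; rewrite scaler_eq0 invr_eq0.
  by rewrite (negPf (neq0CG G)).
pose s := in_submod (specht_mx n lam) v.
pose s' := in_submod (specht_mx n mu) v'.
pose t := in_submod (specht_mx n nu) c.
(* [z] is the functional that reads off the coefficient of the identity. *)
pose e := delta_mx (gring_index G 1) 0 : 'cV[algC]_#|G|.
pose z := val_submod (1%:M : 'M_(\rank (specht_mx n nu))) *m e.
have: kron (kron s s') z^T *m (\sum_(g in G) r g)
    *m kron (kron (val_submod 1%:M) (val_submod 1%:M)) t^T = 0.
  by rewrite r0 mulmx0 mul0mx.
have -> : kron (kron s s') z^T *m (\sum_(g in G) r g)
    *m kron (kron (val_submod 1%:M) (val_submod 1%:M)) t^T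
  = kron (kron v v' *m (\sum_g c 0 (gring_index G g) *: kron (aG g) (aG g)))
      (1%:M : 'M_1).
  rewrite mulmx_sumr mulmx_suml mulmx_sumr kron_suml.
  apply: eq_big => [g|g Gg]; first by rewrite inE.
  rewrite !kronM -!val_submodE !val_submodJ ?inE //.
  rewrite !in_submodK // -scalemxAr kronM.
  rewrite -!trmx_mul mulmxA mulmxA -val_submodE val_submodJ ?groupV //.
  rewrite in_submodK ?cyclic_mx_id //.
  suff -> : (c *m aG g^-1%g *m e)^T = c 0 (gring_index G g) *: 1%:M.
    by rewrite kronZr kronZl.
  rewrite [_ *m e]mx11_scalar tr_scalar_mx scalemx1; congr _%:M.
  rewrite -colE mxE row_regular_mx ?groupV ?group1 //.
  by rewrite mul1g invgK.
move/matrixP => X0; apply/matrixP => i j.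
have := X0 (mxvec_index i 0) (mxvec_index j 0).
by rewrite kronE !mxE mulr1.
Qed.

End CharacterProducts.

(** * Stabilizers and twisted group sums *)

Section PermutationGroups.

Variable n : nat.
Implicit Types (A B : {set 'I_n}) (s t : 'S_n).

Definition label_stab (T : eqType) (f : 'I_n -> T) : {set 'S_n} :=
  [set s : 'S_n | [forall i, f (s i) == f i]].

Lemma label_stabP (T : eqType) (f : 'I_n -> T) s :
  reflect (forall i, f (s i) = f i) (s \in label_stab f).
Proof. by rewrite inE; apply: (iffP forallP) => h i; apply/eqP. Qed.

Lemma group_set_label_stab (T : eqType) (f : 'I_n -> T) :
  group_set (label_stab f).
Proof.
apply/group_setP; split=> [|s t]; first by apply/label_stabP=> i; rewrite perm1.
move=> /label_stabP fs /label_stabP ft; apply/label_stabP=> i.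
by rewrite permM ft fs.
Qed.
Canonical label_stab_group (T : eqType) (f : 'I_n -> T) :=
  Group (group_set_label_stab f).

Lemma tperm_label_stab (T : eqType) (f : 'I_n -> T) i j :
  f i = f j -> tperm i j \in label_stab f.
Proof.
by move=> fij; apply/label_stabP=> l; case: tpermP => [->|->|]; rewrite ?fij.
Qed.

Definition supp_perm A : {set 'S_n} := [set s : 'S_n | perm_on A s].

Lemma supp_permP A s :
  reflect (forall i, i \notin A -> s i = i) (s \in supp_perm A).
Proof.
rewrite inE; apply: (iffP idP) => [sA i nAi|sA]; first exact: out_perm nAi.
by apply/subsetP=> i; rewrite inE; apply: contraR => /sA ->.
Qed.

Lemma group_set_supp_perm A : group_set (supp_perm A).
Proof.
apply/group_setP; split=> [|s t]; first by rewrite inE perm_on1.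
by rewrite !inE; apply: perm_onM.
Qed.
Canonical supp_perm_group A := Group (group_set_supp_perm A).

Lemma supp_perm_closed A s i : s \in supp_perm A -> (s i \in A) = (i \in A).
Proof. by rewrite inE => /perm_closed. Qed.

Lemma tperm_supp_perm A i j :
  i \in A -> j \in A -> tperm i j \in supp_perm A.
Proof.
move=> Ai Aj; apply/supp_permP=> l nAl.
by rewrite tpermD //; apply: contraNneq nAl => <-.
Qed.

Lemma supp_perm0 : supp_perm set0 = 1%g.
Proof.
apply/setP=> s; rewrite inE [RHS]inE; apply/idP/eqP => [s0|->]; last first.
  exact: perm_on1.
by apply/permP=> i; rewrite perm1 (out_perm s0) ?inE.
Qed.

Lemma commute_supp_perm A B s t : [disjoint A & B] ->
  s \in supp_perm A -> t \in supp_perm B -> commute s t.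
Proof.
move=> dAB sA tB; apply/permP=> i; rewrite !permM.
have [Ai|nAi] := boolP (i \in A).
  move: sA tB => /[dup] /supp_perm_closed clA _ /supp_permP fB.
  by rewrite !fB //; apply/negP=> Bi; [have := disjointFr dAB Ai
    | have := disjointFr dAB (etrans (clA i) Ai)]; rewrite Bi.
have [Bi|nBi] := boolP (i \in B).
  move: tB => /supp_perm_closed clB.
  move/supp_permP: sA => fA; rewrite !fA //; apply/negP=> Ai.
  by have := disjointFr dAB Ai; rewrite clB Bi.
by rewrite (supp_permP _ _ sA) // (supp_permP _ _ tB) // (supp_permP _ _ sA).
Qed.

(** Each [g] in [H] is the product of [g * tperm t (g t)], which fixes [t], and
    of a transposition. *)
Lemma sum_transposition_cosets (V : nmodType) (H : {group 'S_n})
    (H0 : {set 'S_n}) (t : 'I_n) A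
    (F : 'S_n -> V) :
  (forall h, (h \in H0) = (h \in H) && (h t == t)) ->
  (forall h, h \in H -> h t \in A) ->
  (forall y, y \in A -> tperm t y \in H) ->
  \sum_(g in H) F g = \sum_(y in A) \sum_(h in H0) F (h * tperm t y)%g.
Proof.
move=> H0E orbA tpH.
rewrite (partition_big (fun g : 'S_n => g t) (mem A)) //=.
apply: eq_bigr => y Ay; rewrite (reindex_inj (mulIg (tperm t y))) /=.
apply: eq_bigl => h; rewrite H0E groupMr ?tpH // permM; congr (_ && _).
by rewrite -{2}(tpermL t y) (inj_eq perm_inj).
Qed.

End PermutationGroups.

Section GroupSums.

Variables (n m : nat) (rho : 'S_n -> 'M[algC]_m).
Hypothesis rho1 : rho 1%g = 1%:M.
Hypothesis rhoM : {morph rho : g h / (g * h)%g >-> g *m h}.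

(** The flag selects between the plain and the signed sum, so that row and
    column (anti)symmetrizers share their theory. *)
Definition twist (e : bool) (g : 'S_n) : algC := (-1) ^+ (e && odd_perm g).

Lemma twistM e : {morph twist e : g h / (g * h)%g >-> g * h}.
Proof.
by move=> g h; rewrite /twist odd_permM; case: e => /=; rewrite ?mulr1 // signr_addb.
Qed.

Lemma twistV e g : twist e g^-1 = twist e g.
Proof. by rewrite /twist odd_permV. Qed.

Lemma twist_sqr e g : twist e g * twist e g = 1.
Proof. by rewrite /twist -signr_addb addbb. Qed.

Lemma twist1 e : twist e 1 = 1.
Proof. by rewrite /twist odd_perm1 andbF. Qed.

Definition gsum e (H : {set 'S_n}) := \sum_(g in H) twist e g *: rho g.

Lemma gsumMr e (H : {group 'S_n}) h :
  h \in H -> gsum e H *m rho h = twist e h *: gsum e H.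
Proof.
move=> Hh; rewrite mulmx_suml scaler_sumr -[RHS](sum_group_mulr _ Hh).
by apply: eq_bigr => g _; rewrite -scalemxAl rhoM scalerA twistM mulrCA twist_sqr mulr1.
Qed.

Lemma gsumMl e (H : {group 'S_n}) h :
  h \in H -> rho h *m gsum e H = twist e h *: gsum e H.
Proof.
move=> Hh; rewrite mulmx_sumr scaler_sumr -[RHS](sum_group_mull _ Hh).
by apply: eq_bigr => g _; rewrite -scalemxAr rhoM scalerA twistM mulrA twist_sqr mul1r.
Qed.

Lemma gsum_subl e (H K : {group 'S_n}) : K \subset H ->
  gsum e K *m gsum e H = #|K|%:R *: gsum e H.
Proof.
move=> /subsetP sKH; rewrite mulmx_suml.
rewrite (eq_bigr (fun=> gsum e H)) ?sumr_const ?scaler_nat // => g Kg.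
by rewrite -scalemxAl gsumMl ?sKH // scalerA twist_sqr scale1r.
Qed.

Lemma gsum_subr e (H K : {group 'S_n}) : K \subset H ->
  gsum e H *m gsum e K = #|K|%:R *: gsum e H.
Proof.
move=> /subsetP sKH; rewrite mulmx_sumr.
rewrite (eq_bigr (fun=> gsum e H)) ?sumr_const ?scaler_nat // => g Kg.
by rewrite -scalemxAr gsumMr ?sKH // scalerA twist_sqr scale1r.
Qed.

Lemma gsum1 e : gsum e 1%g = 1%:M.
Proof. by rewrite /gsum big_set1 twist1 scale1r rho1. Qed.

Lemma gsum_comm e (H : {set 'S_n}) h :
  {in H, forall g, commute g h} -> gsum e H *m rho h = rho h *m gsum e H.
Proof.
move=> cHh; rewrite mulmx_suml mulmx_sumr; apply: eq_bigr => g Hg.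
by rewrite -scalemxAl -scalemxAr -!rhoM cHh.
Qed.

Lemma gsum_cosets e (H : {group 'S_n}) (H0 : {set 'S_n}) (t : 'I_n) (A : {set 'I_n}) :
  (forall h, (h \in H0) = (h \in H) && (h t == t)) ->
  (forall h, h \in H -> h t \in A) ->
  (forall y, y \in A -> tperm t y \in H) ->
  gsum e H = gsum e H0 *m
    \sum_(y in A) twist e (tperm t y) *: rho (tperm t y).
Proof.
move=> H0E orbA tpH; rewrite /gsum (sum_transposition_cosets _ H0E orbA tpH).
rewrite mulmx_sumr; apply: eq_bigr => y _; rewrite mulmx_suml.
apply: eq_bigr => h _.
by rewrite -scalemxAl -scalemxAr scalerA rhoM twistM.
Qed.

Lemma gsum_supp_perm e (A : {set 'I_n}) x : x \notin A ->
  gsum e (supp_perm (x |: A)) = gsum e (supp_perm A) *m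
    \sum_(y in x |: A) twist e (tperm x y) *: rho (tperm x y).
Proof.
move=> nAx; apply: (@gsum_cosets _ (supp_perm_group _)) => [h|h hA|y Ay].
- apply/supp_permP/andP => [hA|[/supp_permP hA /eqP hx] i nAi].
    split; last by rewrite hA.
    by apply/supp_permP=> i; rewrite !inE => /norP[_ /hA].
  have [->//|ne_ix] := eqVneq i x.
  by apply: hA; rewrite !inE negb_or ne_ix.
- by rewrite (supp_perm_closed _ hA) setU11.
- by rewrite tperm_supp_perm // setU11.
Qed.

End GroupSums.

(** * Positivity, and products of disjoint transpositions *)

Section Adjoint.

Definition adjmx m n (M : 'M[algC]_(m, n)) : 'M_(n, m) := (map_mx Num.conj M)^T.

Lemma adjmxM m n p (A : 'M_(m, n)) (B : 'M_(n, p)) :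
  adjmx (A *m B) = adjmx B *m adjmx A.
Proof. by rewrite /adjmx map_mxM trmx_mul. Qed.

Lemma trace_adjmx_ge0 m n (A : 'M_(m, n)) : 0 <= \tr (A *m adjmx A).
Proof.
apply: sumr_ge0 => i _; rewrite mxE; apply: sumr_ge0 => j _.
by rewrite !mxE mul_conjC_ge0.
Qed.

Lemma trace_adjmx_gt0 m n (A : 'M_(m, n)) : A != 0 -> 0 < \tr (A *m adjmx A).
Proof.
move=> nzA; rewrite lt_def trace_adjmx_ge0 andbT; apply: contra nzA.
rewrite psumr_eq0 => [/allP A0|i _]; last first.
  by rewrite mxE; apply: sumr_ge0 => j _; rewrite !mxE mul_conjC_ge0.
apply/eqP/matrixP => i j; rewrite mxE; move: (A0 i (mem_index_enum i)).
rewrite /= mxE psumr_eq0 => [/allP /(_ j (mem_index_enum j)) /=|k _].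
  by rewrite !mxE mul_conjC_eq0 => /eqP.
by rewrite !mxE mul_conjC_ge0.
Qed.

Variables (n m : nat) (rho : 'S_n -> 'M[algC]_m).
Hypothesis rhoV : forall g, adjmx (rho g) = rho g^-1%g.

Lemma adjmx_gsum e (H : {group 'S_n}) : adjmx (gsum rho e H) = gsum rho e H.
Proof.
rewrite /adjmx raddf_sum /= raddf_sum /= [RHS](reindex_inj invg_inj) /=.
apply: eq_big => [g|g _]; first by rewrite groupV.
rewrite twistV -rhoV map_mxZ linearZ /=; congr (_ *: _).
by rewrite /twist rmorphXn rmorphN1.
Qed.

End Adjoint.

Section SwapProducts.

Variable n : nat.
Implicit Types s : seq ('I_n * 'I_n).

Definition swaps s : 'S_n :=
  foldr (fun p g => g * tperm p.1 p.2)%g 1%g s.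

Lemma swaps_out s i : i \notin unzip1 s ++ unzip2 s -> swaps s i = i.
Proof.
elim: s => [|[t x] s IHs] /=; first by rewrite perm1.
rewrite inE mem_cat inE !negb_or => /and4P[ne_it nsi ne_ix n2i].
by rewrite permM IHs ?mem_cat ?negb_or ?nsi // tpermD // eq_sym.
Qed.

(** Since the pairs are disjoint, [swaps s] exchanges the members of each. *)
Lemma swaps_image s i : uniq (unzip1 s ++ unzip2 s) ->
  (swaps s i \in unzip2 s) = (i \in unzip1 s).
Proof.
elim: s => [|[t x] s IHs] //=.
rewrite cat_uniq /= mem_cat inE !negb_or => /andP[/and3P[n1t ne_tx n2t]].
case/and3P=> u1 /andP[n1x n12] /andP[n2x u2].
have us : uniq (unzip1 s ++ unzip2 s) by rewrite cat_uniq u1 n12.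
have ft : swaps s t = t by rewrite swaps_out // mem_cat negb_or n1t.
have fx : swaps s x = x by rewrite swaps_out // mem_cat negb_or n1x.
rewrite permM !inE -(IHs us).
have [->|ne_it] := eqVneq i t; first by rewrite ft tpermL eqxx.
have [->|ne_ix] := eqVneq i x.
  by rewrite fx tpermR (negPf ne_tx) (negPf n2t) (negPf n2x).
have neq z : z != i -> swaps s z = z -> z != swaps s i.
  by move=> ne fz; rewrite -{1}fz (inj_eq perm_inj).
rewrite tpermD ?neq // 1?eq_sym //.
by rewrite (negPf (neq _ _ fx)) // eq_sym.
Qed.

End SwapProducts.

(** * Column antisymmetrizers on vectors of full depth *)

Section Depth.

Variables (n m q : nat) (rho : 'S_n -> 'M[algC]_m).
Hypothesis rho1 : rho 1%g = 1%:M.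
Hypothesis rhoM : {morph rho : g h / (g * h)%g >-> g *m h}.
Hypothesis rhoV : forall g, adjmx (rho g) = rho g^-1%g.

(** These two conditions say that the constituents met by [w] belong to
    diagrams whose first row has exactly [#|al|] cells: invariance bounds the
    length from below, and [w_kill] from above. *)
Variables (al : {set 'I_n}) (w : 'M[algC]_(q, m)).
Hypothesis w_inv : {in supp_perm al, forall g, w *m rho g = w}.
Hypothesis w_kill : forall x, x \notin al ->
  \sum_(y in x |: al) w *m rho (tperm x y) = 0.

Let aK := gsum rho false (supp_perm al).

Lemma sym_invariant : w *m aK = #|supp_perm al|%:R *: w.
Proof.
rewrite mulmx_sumr scaler_nat -sumr_const; apply: eq_bigr => g Kg.
by rewrite /twist expr0 scale1r w_inv.
Qed.

Lemma sym_absorb g : g \in supp_perm al -> rho g *m aK = aK.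
Proof. by move=> Kg; rewrite gsumMl // /twist expr0 scale1r. Qed.

(** The transposition of [t] and [t'] commutes with [swaps s] and is absorbed
    by [w] on one side and by the sum over [al] on the other. *)
Lemma swaps_free_label (s : seq ('I_n * 'I_n)) t t' x :
  t \in al -> t' \in al -> x \notin al ->
  t \notin unzip1 s ++ unzip2 s -> t' \notin unzip1 s ++ unzip2 s ->
  w *m rho (swaps s) *m rho (tperm x t) *m aK
    = w *m rho (swaps s) *m rho (tperm x t') *m aK.
Proof.
move=> At At' nAx /swaps_out ft /swaps_out ft'; set k := tperm t t'.
have Kk : k \in supp_perm al by exact: tperm_supp_perm.
have wk : w *m rho (swaps s) = w *m rho (swaps s) *m rho k.
  rewrite -mulmxA -rhoM -{1}(w_inv Kk) -mulmxA -rhoM conjgC /k tpermJ.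
  by rewrite ft ft'.
rewrite {1}wk -!mulmxA; congr (_ *m (_ *m _)).
have nx y : y \in al -> y != x by move=> Ay; apply: contraNneq nAx => <-.
have -> : tperm x t = (k^-1 * tperm x t' * k)%g.
  by rewrite /k -mulgA -conjgE tpermJ tpermR tpermD // nx.
by rewrite mulmxA -rhoM !mulgA mulgV mul1g rhoM -mulmxA sym_absorb.
Qed.

(** The induction multiplies the relation [w_kill] for the new point [x] by
    [swaps s].  The points of [al] not used by [s] all give the same term; the
    used ones become transpositions of [x] with points outside [al], and these
    extend the symmetrizer of the points already treated. *)
Lemma swaps_sym (s : seq ('I_n * 'I_n)) :
  uniq (unzip1 s) -> {subset unzip1 s <= al} ->
  uniq (unzip2 s) -> {in unzip2 s, forall x, x \notin al} ->
  exists2 c : algC, 0 < c &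
    (-1) ^+ size s *: (w *m rho (swaps s) *m aK)
      = c *: (w *m gsum rho false (supp_perm [set x in unzip2 s])).
Proof.
elim: s => [|[t x] s IHs] /=.
  move=> _ _ _ _; exists #|supp_perm al|%:R; first by rewrite ltr0n cardG_gt0.
  rewrite scale1r rho1 mulmx1 sym_invariant; congr (_ *: _).
  have -> : [set x in [::]] = set0 :> {set 'I_n} by apply/setP=> i; rewrite !inE.
  by rewrite supp_perm0 gsum1 // mulmx1.
case/andP=> n1t u1 sub /andP[n2x u2] out.
have At : t \in al by rewrite sub ?mem_head.
have nAx : x \notin al by rewrite out ?mem_head.
have sub1 : {subset unzip1 s <= al} by move=> y sy; rewrite sub // inE sy orbT.
have out2 : {in unzip2 s, forall x, x \notin al}.
  by move=> y sy; rewrite out // inE sy orbT.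
have [c c_gt0 IH] := IHs u1 sub1 u2 out2.
pose S := swaps s; pose Phi := w *m rho (swaps s * tperm t x) *m aK.
have us : uniq (unzip1 s ++ unzip2 s).
  rewrite cat_uniq u1 u2 andbT /=; apply/hasPn => y /out2.
  by apply: contra => /sub1.
have n12 y : y \in al -> y \notin unzip1 s -> y \notin unzip1 s ++ unzip2 s.
  move=> Ay n1y; rewrite mem_cat negb_or n1y /=.
  by apply: contraL Ay => /out2.
have fx : S x = x.
  rewrite /S swaps_out // mem_cat negb_or n2x andbT.
  by apply: contra nAx => /sub1.
pose xs := [set z in unzip2 s]; pose ts := [set z in unzip1 s].
have tsA : ts \subset al by apply/subsetP=> y; rewrite inE => /sub1.
have nxsx : x \notin xs by rewrite inE.
pose f y := w *m rho S *m rho (tperm x (S y)) *m aK.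
have f0 : \sum_(y in x |: al) f y = 0.
  have := congr1 (fun M => M *m rho S *m aK) (w_kill nAx).
  rewrite !mulmx_suml !mul0mx => w0; rewrite -[RHS]w0; apply: eq_bigr => y _.
  rewrite /f; congr (_ *m _).
  by rewrite -!mulmxA -!rhoM (conjgC (tperm x y)) tpermJ fx.
have f_free : \sum_(y in al :\: ts) f y = (#|al| - size s)%:R *: Phi.
  rewrite (eq_bigr (fun=> Phi)) => [|y].
    rewrite sumr_const scaler_nat cardsD; congr (_ *+ (_ - _)).
    by rewrite (setIidPr tsA) cardsE (card_uniqP u1) size_map.
  rewrite !inE => /andP[n1y Ay]; rewrite /f /S swaps_out ?n12 //.
  rewrite (swaps_free_label (t' := t)) ?n12 // /Phi rhoM !mulmxA.
  by rewrite [tperm t x]tpermC.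
have f_used : \sum_(y in x |: ts) f y
    = (-1) ^+ size s * c *: (w *m gsum rho false (supp_perm (x |: xs))).
  pose F z := w *m rho S *m rho (tperm x z) *m aK.
  have -> : \sum_(y in x |: ts) f y = \sum_(z in x |: xs) F z.
    rewrite [RHS](reindex_inj (@perm_inj _ S)) /=; apply: eq_bigl => y.
    by rewrite !inE swaps_image // -{2}fx (inj_eq perm_inj).
  rewrite gsum_supp_perm // mulmxA -scalerA scalemxAl -IH scalemxAl scalerA.
  rewrite -exprD addnn -mul2n exprM sqrrN expr1n expr1n scale1r mulmx_sumr.
  apply: eq_bigr => z xsz; rewrite /F /twist expr0 scale1r -!mulmxA.
  congr (_ *m (_ *m _)); rewrite gsum_comm // => g Kg.
  apply: (@commute_supp_perm _ al (~: al)) => //.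
    by rewrite disjoints_subset setCK.
  apply: tperm_supp_perm; rewrite inE //.
  by move: xsz; rewrite !inE => /predU1P[->|/out2].
have sz : (size s < #|al|)%N.
  have <- : #|[set z in t :: unzip1 s]| = (size s).+1.
    by rewrite cardsE (card_uniqP _) /= ?n1t // size_map.
  by apply/subset_leq_card/subsetP=> y; rewrite inE => /sub.
have a_gt0 : 0 < (#|al| - size s)%:R :> algC by rewrite ltr0n subn_gt0.
exists (c / (#|al| - size s)%:R); first by rewrite divr_gt0.
apply: (scalerI (lt0r_neq0 a_gt0)); rewrite !scalerA mulrCA divff ?lt0r_neq0 // mulr1.
rewrite mulrC -scalerA -/Phi -f_free.
have {f0} -> : \sum_(y in al :\: ts) f y = - \sum_(y in x |: ts) f y.
  apply/eqP; rewrite -addr_eq0 -[X in _ == X]f0.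
  rewrite [X in _ == X](big_setID (x |: ts)) /= addrC.
  have -> : (x |: al) :&: (x |: ts) = x |: ts.
    by apply/setIidPr; rewrite setUS.
  suff -> : (x |: al) :\: (x |: ts) = al :\: ts by [].
  apply/setP=> y; rewrite !inE; case: eqVneq => //= ->.
  by rewrite (negPf nAx) andbF.
rewrite f_used -scalerN scalerA exprS mulN1r mulNr scaleNr scalerN opprK.
rewrite -signr_odd mulrA -expr2 sqrr_sign mul1r.
congr (_ *: (_ *m gsum _ _ (supp_perm _))).
by apply/setP=> z; rewrite !inE.
Qed.

Variables (C : eqType) (cm : 'I_n -> C).
Hypothesis cm_inj : {in al &, injective cm}.

Definition col_factor t :=
  \sum_(y in [set y | cm y == cm t]) twist true (tperm t y) *: rho (tperm t y).

Definition col_factors ts := foldr (fun t M => col_factor t *m M) 1%:M ts.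

(** A column contains at most one point of [al], so the permutations of a
    column still act on it transitively when other points of [al] are fixed. *)
Lemma gsum_col_factors (ts : seq 'I_n) : uniq ts -> {subset ts <= al} ->
  gsum rho true (label_stab cm) =
  gsum rho true (label_stab cm :&: supp_perm (~: [set t in ts]))
    *m col_factors ts.
Proof.
elim: ts => [|t ts IHs] /=.
  move=> _ _; rewrite mulmx1; congr (gsum _ _ _).
  apply/esym/setIidPl/subsetP => g _; apply/supp_permP=> i.
  by rewrite !inE.
case/andP=> nts us sub; rewrite IHs //; last first.
  by move=> y sy; rewrite sub // inE sy orbT.
have At : t \in al by rewrite sub ?mem_head.
rewrite mulmxA; congr (_ *m _).
apply: (@gsum_cosets _ _ _ rhoM true (label_stab_group cm :&: supp_perm_group _)%G).
- move=> g; rewrite !in_setI; rewrite -andbA; congr (_ && _).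
  apply/supp_permP/andP => [gs|[/supp_permP gs /eqP gt] i].
    split; last by rewrite gs // !inE eqxx.
    by apply/supp_permP=> i; rewrite !inE negbK => si; rewrite gs // !inE si orbT.
  by rewrite !inE negbK => /predU1P[->//|si]; rewrite gs // !inE negbK.
- by move=> g /setIP[/label_stabP gc _]; rewrite inE gc.
move=> y; rewrite inE => /eqP cy; rewrite inE tperm_label_stab //=.
apply/supp_permP=> i; rewrite !inE negbK => si.
have ne_it : t != i by apply: contraNneq nts => ->.
rewrite tpermD //; apply: contraNneq ne_it => y_i.
by rewrite -(inj_in_eq cm_inj) // ?sub ?inE ?si ?orbT // -y_i cy.
Qed.

(** Expanding the column factors produces products of transpositions, with
    signs that cancel those of [swaps_sym].  Every term is then a symmetrizer,
    hence a nonnegative form, and the term without transpositions is a positive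
    multiple of the squared norm of [w]. *)
Lemma swaps_col_factors_ge0 (s : seq ('I_n * 'I_n)) ts :
  uniq (unzip1 s ++ ts) -> {subset unzip1 s ++ ts <= al} ->
  uniq (unzip2 s) -> {in unzip2 s, forall x, x \notin al} ->
  {in s, forall p, cm p.2 = cm p.1} ->
  let M := (-1) ^+ size s *: (w *m rho (swaps s) *m col_factors ts *m aK) in
  0 <= \tr (M *m adjmx w) /\ (s = [::] -> w != 0 -> 0 < \tr (M *m adjmx w)).
Proof.
elim: ts s => [|t ts IHs] s /=.
  rewrite cats0 mulmx1 => us1 sub us2 out _.
  have [c c_gt0 ->] := swaps_sym us1 sub us2 out; split=> [|-> nzw].
    rewrite -scalemxAl mxtraceZ; apply: mulr_ge0; first exact: ltW.
    set Y := supp_perm_group [set x in unzip2 s].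
    have Ygt0 : 0 < #|Y|%:R :> algC by rewrite ltr0n cardG_gt0.
    rewrite -(pmulr_rge0 _ Ygt0) -mxtraceZ scalemxAl scalemxAr.
    rewrite -(gsum_subr rhoM false (subxx Y)).
    rewrite -{2}(adjmx_gsum rhoV false Y).
    by rewrite (mulmxA w) -[X in \tr X]mulmxA -adjmxM trace_adjmx_ge0.
  rewrite /= (_ : [set x in [::]] = set0); last by apply/setP=> i; rewrite !inE.
  rewrite supp_perm0 gsum1 // mulmx1 -scalemxAl mxtraceZ.
  by rewrite mulr_gt0 // trace_adjmx_gt0.
move=> us1 sub us2 out cs.
have ut : uniq (t :: unzip1 s ++ ts).
  by rewrite -[t :: _]/([:: t] ++ unzip1 s ++ ts) uniq_catCA.
have At : t \in al by rewrite sub // mem_cat mem_head orbT.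
have M_split : (-1) ^+ size s *:
    (w *m rho (swaps s) *m (col_factor t *m col_factors ts) *m aK)
  = (-1) ^+ size s *: (w *m rho (swaps s) *m col_factors ts *m aK)
  + \sum_(x in [set y | cm y == cm t] :\ t)
     (-1) ^+ size ((t, x) :: s) *:
       (w *m rho (swaps ((t, x) :: s)) *m col_factors ts *m aK).
  rewrite /col_factor (bigD1 t) ?inE //= mulmxDl mulmxDr mulmxDl scalerDr.
  rewrite tperm1 twist1 scale1r rho1 mul1mx; congr (_ + _).
  rewrite mulmx_suml mulmx_sumr mulmx_suml scaler_sumr.
  apply: eq_big => [x|x /andP[_ ne_xt]]; first by rewrite !inE andbC.
  rewrite rhoM /twist odd_tperm eq_sym ne_xt /= expr1 exprS.
  by rewrite !scaleN1r mulN1r scaleNr -scalerN !mulNmx !mulmxN !mulmxA !mulNmx.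
rewrite M_split mulmxDl mxtraceD [(\sum_(_ in _ :\ _) _) *m _]mulmx_suml.
rewrite [\tr (\sum_(_ in _ :\ _) _)]raddf_sum.
have us1' : uniq (unzip1 s ++ ts) by case/andP: ut.
have sub' : {subset unzip1 s ++ ts <= al}.
  by move=> y; rewrite mem_cat => /orP[|] sy; rewrite sub // mem_cat ?inE sy ?orbT.
have [ge0 gt0] := IHs s us1' sub' us2 out cs.
suff sum_ge0 : 0 <= \sum_(x in [set y | cm y == cm t] :\ t)
     \tr ((-1) ^+ size ((t, x) :: s) *:
       (w *m rho (swaps ((t, x) :: s)) *m col_factors ts *m aK) *m adjmx w).
  by split=> [|s0 nzw]; [exact: (addr_ge0 ge0 sum_ge0) | exact: ltr_pwDl (gt0 s0 nzw) sum_ge0].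
apply: sumr_ge0 => x; rewrite !inE => /andP[ne_xt /eqP cx].
apply: (proj1 (IHs ((t, x) :: s) _ _ _ _ _)) => //=.
- by move=> y; rewrite inE => /predU1P[->//|/sub'].
- rewrite us2 andbT; apply/negP=> /mapP[p sp x_p].
  have := cs _ sp; rewrite -x_p cx => /(cm_inj At).
  have p1 : p.1 \in unzip1 s by exact: map_f.
  rewrite sub ?mem_cat ?p1 // => /(_ isT) t_p.
  by move: ut; rewrite /= mem_cat t_p p1.
- move=> y; rewrite inE => /predU1P[->|/out//].
  by apply/negP=> Ax; case/eqP: ne_xt; apply: cm_inj.
- by move=> p; rewrite inE => /predU1P[->|/cs].
Qed.

Lemma col_antisymmetrizer_neq0 :
  w != 0 -> w *m col_factors (enum al) != 0.
Proof.
move=> nzw; have [] := @swaps_col_factors_ge0 [::] (enum al) => //=.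
- exact: enum_uniq.
- by move=> t; rewrite mem_enum.
rewrite scale1r rho1 mulmx1 => _ /(_ erefl nzw) tr_gt0.
by apply: contraTneq tr_gt0 => ->; rewrite !mul0mx mxtrace0 ltxx.
Qed.

End Depth.

(** * The regular representation *)

Section RegularRepresentation.

Variable n : nat.
Local Notation G := [set: 'S_n]%G.
Local Notation aG := (regular_repr algC G).

Lemma reg1 : aG 1%g = 1%:M.
Proof. exact: repr_mx1. Qed.

Lemma regM : {morph aG : g h / (g * h)%g >-> g *m h}.
Proof. by move=> g h; rewrite repr_mxM ?inE. Qed.

Lemma regV g : adjmx (aG g) = aG g^-1%g.
Proof.
apply/matrixP => i j; rewrite !mxE rmorph_nat; congr ((nat_of_bool _)%:R).
rewrite !eqxx /=; apply/eqP/eqP=> ->; rewrite gring_indexK ?inE //.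
  by rewrite mulgK gring_valK.
by rewrite mulgKV gring_valK.
Qed.

Lemma tr_reg g : \tr (aG g) = (#|G| * (g == 1%g))%:R.
Proof.
have := congr1 (fun phi : 'CF(G) => phi g) (cfReprReg G).
rewrite /= cfunE inE mulr1n => ->; rewrite cfRegE.
by case: (g == 1%g); rewrite ?muln1 ?muln0.
Qed.

Lemma gsum_group_ring e (H : {set 'S_n}) :
  (gsum aG e H \in group_ring algC G)%MS.
Proof.
rewrite /gsum linear_sum /=; apply: summx_sub => g _.
by rewrite linearZ /=; apply: scalemx_sub; exact: envelop_mx_id.
Qed.

Definition rho2 (g : 'S_n) := kron (aG g) (aG g).

Lemma rho21 : rho2 1%g = 1%:M.
Proof. by rewrite /rho2 reg1 kron1. Qed.

Lemma rho2M : {morph rho2 : g h / (g * h)%g >-> g *m h}.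
Proof. by move=> g h; rewrite /rho2 regM kronM. Qed.

Lemma rho2V g : adjmx (rho2 g) = rho2 g^-1%g.
Proof. by rewrite /adjmx map_kron kron_tr -/(adjmx _) regV. Qed.

Local Notation d1 := (delta_mx 0 (gring_index G 1) : 'rV[algC]_#|G|).

Lemma delta_reg g : d1 *m aG g = delta_mx 0 (gring_index G g).
Proof.
rewrite -rowE; apply/rowP => j; rewrite !mxE gring_indexK ?group1 // mul1g.
by rewrite eqxx eq_sym.
Qed.

Lemma group_ring_eq0 M : (M \in group_ring algC G)%MS -> d1 *m M = 0 -> M = 0.
Proof.
move=> GM M0; rewrite -(gring_rowK GM).
by rewrite /gring_row rowE M0 linear0.
Qed.

(** Write [a], [b], [a'], [b'] for the sums over [R], [C], [R'], [C'].  Up to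
    positive factors the trace of [a b a b' a'] is the squared norm of
    [b' a b], and the trace of [b' a b] is nonzero since only the identity of
    [R :&: C] contributes to that of [b a]. *)
Lemma sandwich_neq0 (R C R' C' : {group 'S_n}) :
  R :&: C = 1%g -> R' \subset R -> C' \subset C ->
  d1 *m (gsum aG false R *m gsum aG true C *m gsum aG false R
           *m gsum aG true C' *m gsum aG false R') != 0.
Proof.
move=> tiRC sR sC; set a := gsum aG false R; set b := gsum aG true C.
set b' := gsum aG true C'; set a' := gsum aG false R'.
have tr_ba : \tr (b *m a) = #|G|%:R.
  rewrite mulmx_suml raddf_sum /= (bigD1 1%g) //= big1 ?addr0 => [|q /andP[Cq ne_q]].
    rewrite twist1 scale1r reg1 mul1mx raddf_sum /= (bigD1 1%g) //= big1 ?addr0.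
      by rewrite twist1 scale1r tr_reg eqxx muln1.
    move=> p /andP[Rp /negPf ne_p].
    by rewrite mxtraceZ tr_reg ne_p muln0 mulr0.
  rewrite mulmx_sumr raddf_sum /= big1 // => p Rp.
  rewrite -scalemxAl -scalemxAr !mxtraceZ -regM tr_reg -eq_invg_mul.
  case: eqP => [q_p|]; last by rewrite muln0 !mulr0.
  have: q \in R :&: C by rewrite inE Cq -groupV q_p Rp.
  by rewrite tiRC inE (negPf ne_q).
apply/eqP => /group_ring_eq0 M0.
have {}M0 : a *m b *m a *m b' *m a' = 0.
  by apply: M0; rewrite !envelop_mxM ?gsum_group_ring.
pose Y := b' *m a *m b.
have adjY : adjmx Y = b *m a *m b'.
  by rewrite !adjmxM !(adjmx_gsum regV) mulmxA.
have trY : \tr (Y *m adjmx Y) = 0.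
  have := congr1 (fun M => \tr M) M0; rewrite mxtrace0 mxtrace_mulC.
  rewrite !mulmxA (gsum_subl regM) // -!scalemxAl mxtraceZ => /eqP.
  rewrite mulf_eq0 (negPf (neq0CG R')) /= => /eqP tr0.
  rewrite adjY /Y !mulmxA -(mulmxA _ b b) (gsum_subl regM) //.
  rewrite -scalemxAr -!scalemxAl mxtraceZ -!mulmxA mxtrace_mulC -!mulmxA.
  rewrite (gsum_subl regM) // -!scalemxAr mxtraceZ !mulmxA tr0.
  by rewrite !mulr0.
have Y0 : Y = 0.
  by apply/eqP/negP => /negP /trace_adjmx_gt0; rewrite trY ltxx.
have : \tr Y = 0 by rewrite Y0 mxtrace0.
rewrite /Y -mulmxA mxtrace_mulC -mulmxA (gsum_subr regM) //.
apply/eqP; rewrite -scalemxAr mxtraceZ mxtrace_mulC tr_ba.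
by rewrite mulf_eq0 !(negPf (neq0CG _)).
Qed.

End RegularRepresentation.

(** * Rows, columns and corners of the staircase *)

Lemma perm_stable (T : finType) (A : {set T}) (s : {perm T}) :
  {in A, forall i, s i \in A} -> forall i, (s i \in A) = (i \in A).
Proof.
move=> sA i; have eA : s @: A = A.
  apply/eqP; rewrite eqEcard card_imset ?leqnn ?andbT; last exact: perm_inj.
  by apply/subsetP=> _ /imsetP[j Aj ->]; exact: sA.
by rewrite -{1}eA mem_imset //; exact: perm_inj.
Qed.

Section Staircase.

Variables (n k d : nat) (r c : 'I_n -> nat).
Hypothesis rc_lt : forall i, (r i + c i < k)%N.
Hypothesis rc_inj : forall i j, r i = r j -> c i = c j -> i = j.

Local Notation G := [set: 'S_n]%G.
Local Notation aG := (regular_repr algC G).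
Local Notation d1 := (delta_mx 0 (gring_index G 1) : 'rV[algC]_#|G|).

(** The corner of row 0 is excluded: it is the spare cell that [witness]
    exchanges with a corner. *)
Definition corners : {set 'I_n} :=
  [set i | (r i + c i == k.-1) && (0 < r i <= d)%N].
Let X := corners.
Let al := ~: X.
Let K := supp_perm al.
Let R0 := label_stab_group r.
Let C0 := label_stab_group c.

Lemma row_col_trivial : R0 :&: C0 = 1%g.
Proof.
apply/setP=> g; rewrite !inE; apply/andP/eqP=> [[/forallP gr /forallP gc]|->].
  by apply/permP=> i; rewrite perm1; apply: rc_inj; apply/eqP.
by split; apply/forallP=> i; rewrite perm1.
Qed.

Lemma corners_inj i j : i \in X -> j \in X -> r i = r j -> i = j.
Proof.
rewrite !inE => /andP[/eqP ei _] /andP[/eqP ej _] rij.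
by apply: rc_inj => //; lia.
Qed.

(** A point of row [i] lies in one of the first [k - i] columns.  So a corner
    sent by [p] within its row and then by [q] within a column to another
    corner cannot go up, and a permutation of the corners that never goes up is
    the identity. *)
Lemma row_col_fix_corners p q : p \in R0 -> q \in C0 ->
  {in X, forall i, (p * q)%g i \in X} -> {in X, forall i, p i = i /\ q i = i}.
Proof.
move=> /label_stabP pr /label_stabP qc sX; set s := (p * q)%g in sX.
have sXE i : (s i \in X) = (i \in X) by exact: perm_stable.
have le_r i : i \in X -> (r i <= r (s i))%N.
  move=> Xi; have es : (r (s i) + c (s i))%N = k.-1.
    by move: (sX _ Xi); rewrite inE => /andP[/eqP].
  move: Xi; rewrite inE => /andP[/eqP ei _].
  by have := rc_lt (p i); rewrite pr -qc -permM -/s; lia.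
(* The row indices of the corners weakly increase but their sum does not. *)
have eq_r i : i \in X -> r (s i) = r i.
  have /leqif_sum[_] : forall j, j \in X ->
      (r j <= r (s j) ?= iff (r j == r (s j)))%N.
    by move=> j Xj; split; first exact: le_r.
  rewrite [X in _ == X](_ : _ = \sum_(j in X) r j).
    by rewrite eqxx => /esym/forall_inP h /h/eqP.
  by rewrite [RHS](reindex_inj (@perm_inj _ s)); apply: eq_bigl => j; rewrite sXE.
move=> i Xi; have si : s i = i by apply: corners_inj; rewrite ?sXE ?eq_r.
have pi : p i = i by apply: rc_inj; rewrite ?pr // -qc -permM si.
by split=> //; rewrite -{1}pi -permM.
Qed.

Lemma supp_perm_alP (g : 'S_n) : reflect {in X, forall i, g i = i} (g \in K).
Proof.
apply: (iffP (supp_permP _ _)) => fg i hi; apply: fg; first by rewrite inE negbK.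
by rewrite inE negbK in hi.
Qed.

Let lam := d1 *m gsum aG false R0 *m gsum aG true C0.
Let Z := delta_mx (gring_index G 1) 0 : 'cV[algC]_#|G|.
Let Ral := (R0 :&: supp_perm_group al)%G.
Let Cal := (C0 :&: supp_perm_group al)%G.

Lemma polytabloidE : lam = \sum_(p in R0) \sum_(q in C0)
  (-1) ^+ q *: delta_mx 0 (gring_index G (p * q)%g).
Proof.
rewrite /lam -mulmxA mulmx_suml mulmx_sumr; apply: eq_bigr => p _.
rewrite !mulmx_sumr; apply: eq_bigr => q _.
by rewrite /twist expr0 scale1r -!scalemxAr -regM delta_reg.
Qed.

Lemma polytabloid_coef g : lam *m aG g *m Z =
  (\sum_(p in R0) \sum_(q in C0) twist true q * (g == q * p)%g%:R)%:M.
Proof.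
rewrite [LHS]mx11_scalar; congr _%:M.
rewrite -colE mxE row_regular_mx ?inE // mul1g polytabloidE summxE.
rewrite (reindex_inj invg_inj); apply: eq_big => [p|p _]; first exact: groupV.
rewrite summxE (reindex_inj invg_inj); apply: eq_big => [q|q _].
  exact: groupV.
rewrite !mxE eqxx -invMg odd_permV; congr (_ * _%:R).
rewrite (inj_in_eq (can_in_inj gring_indexK)) ?inE //.
by rewrite (inj_eq invg_inj).
Qed.

Variable v : 'rV[algC]_#|G|.
Let w := kron lam v *m gsum (@rho2 n) false K.
Let ev := kron Z (1%:M : 'M[algC]_#|G|).
Let w_ev := kron (1%:M : 'M[algC]_1)
  (v *m gsum aG true Cal *m gsum aG false Ral).

Lemma kron_rho2 (u u' : 'rV[algC]_#|G|) g :
  kron u u' *m rho2 g = kron (u *m aG g) (u' *m aG g).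
Proof. exact: kronM. Qed.

Lemma average_inv g : g \in K -> w *m rho2 g = w.
Proof.
move=> Kg; rewrite -mulmxA (gsumMr (@rho2M n) false (H := supp_perm_group al)) //.
by rewrite /twist expr0 scale1r.
Qed.

Lemma average_ev_expand g : w *m rho2 g *m ev =
  \sum_(h in K) \sum_(p in R0) \sum_(q in C0)
    (twist true q * ((h * g)%g == q * p)%g%:R) *: kron 1%:M (v *m aG (h * g)%g).
Proof.
rewrite /w -!mulmxA mulmx_suml mulmx_sumr; apply: eq_bigr => h _.
rewrite {1}/twist expr0 scale1r (mulmxA (rho2 h)) -rho2M mulmxA kron_rho2 kronM.
rewrite mulmx1 polytabloid_coef -scalemx1 kronZl.
rewrite scaler_suml; apply: eq_bigr => p _; rewrite scaler_suml.
by apply: eq_bigr.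
Qed.

Lemma col_row_fix_corners (g : 'S_n) h p q : {in X, forall i, g i \in X} ->
  h \in K -> p \in R0 -> q \in C0 -> (h * g)%g = (q * p)%g ->
  [/\ g \in K, p \in Ral & q \in Cal].
Proof.
move=> sgX Kh Rp Cq hg.
have gX := perm_stable sgX.
have hX i : (h i \in X) = (i \in X).
  by apply: negb_inj; rewrite -!in_setC -/al (supp_perm_closed i Kh).
have pq_fix : {in X, forall i, p^-1%g i = i /\ q^-1%g i = i}.
  apply: row_col_fix_corners; rewrite ?groupV // => i Xi.
  by rewrite -invMg -hg -hX -gX -permM permKV.
have fixV (s : 'S_n) i : s^-1%g i = i -> s i = i by move=> {1}<-; rewrite permKV.
have Kp : p \in K by apply/supp_perm_alP=> i /pq_fix[/fixV].
have Kq : q \in K by apply/supp_perm_alP=> i /pq_fix[_ /fixV].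
split; [|by rewrite in_setI Rp|by rewrite in_setI Cq].
change (g \in supp_perm_group al).
by rewrite -(@groupMl _ (supp_perm_group al) h) // hg groupM.
Qed.

(** The coefficient functional [ev] on the first factor retains the terms
    [h * g = q * p] with [h] in [K], [p] in the row group and [q] in the column
    group; [row_col_fix_corners] puts all of these in [K]. *)
Lemma average_ev (g : 'S_n) : {in X, forall i, g i \in X} ->
  w *m rho2 g *m ev = (g \in K)%:R *: w_ev.
Proof.
move=> sgX; have [Kg|nKg] := boolP (g \in K); last first.
  rewrite scale0r average_ev_expand big1 // => h Kh.
  rewrite big1 // => p Rp; rewrite big1 // => q Cq.
  case: eqP => [hg|_]; last by rewrite mulr0 scale0r.
  by case: (col_row_fix_corners sgX Kh Rp Cq hg); rewrite (negPf nKg).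
rewrite average_inv // scale1r -[w]mulmx1 -rho21 average_ev_expand.
pose F p q := twist true q *: kron (1%:M : 'M[algC]_1) (v *m aG (q * p)%g).
transitivity (\sum_(p in R0 | p \in Ral) \sum_(q in C0 | q \in Cal) F p q).
  rewrite big_mkcondr exchange_big; apply: eq_bigr => p Rp.
  rewrite exchange_big /=.
  have inner q : q \in C0 -> \sum_(h in K)
      (twist true q * ((h * 1)%g == (q * p)%g)%:R) *: kron 1%:M (v *m aG (h * 1)%g)
    = if (p \in Ral) && (q \in Cal) then F p q else 0 :> 'M_(1 * 1, _).
    move=> Cq; case: ifP => [/andP[Pp Pq]|npq].
      rewrite (bigD1 (q * p)%g) /=; last first.
        by move: Pp Pq; rewrite !in_setI => /andP[_ Kp] /andP[_ Kq]; exact: groupM.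
      rewrite mulg1 eqxx mulr1 big1 ?addr0 // => h /andP[_ /negPf ne_h].
      by rewrite mulg1 ne_h mulr0 scale0r.
    rewrite big1 // => h Kh; case: eqP => [h_qp|_]; last by rewrite mulr0 scale0r.
    have [|_ Pp Pq] := @col_row_fix_corners 1%g h p q _ Kh Rp Cq h_qp.
      by move=> i; rewrite perm1.
    by rewrite Pp Pq in npq.
  case: (boolP (p \in Ral)) => Pp.
    by rewrite big_mkcondr; apply: eq_bigr => q Cq; rewrite inner // Pp.
  by rewrite big1 // => q Cq; rewrite inner // (negPf Pp).
rewrite /w_ev mulmx_sumr kron_sumr.
have subl (A B : {group 'S_n}) s :
    (s \in A) && (s \in (A :&: B)%G) = (s \in (A :&: B)%G).
  by apply: andb_idl; rewrite in_setI => /andP[].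
rewrite (eq_bigl _ _ (subl _ _)).
apply: eq_bigr => p _; rewrite (eq_bigl _ _ (subl _ _)).
rewrite mulmx_sumr mulmx_suml kron_sumr.
apply: eq_bigr => q _; rewrite /F -!scalemxAr -!scalemxAl !kronZr.
by rewrite [twist false p]expr0 scale1r regM mulmxA.
Qed.

End Staircase.

(** * Young symmetrizers whose first row avoids the corners *)

Section Assembly.

Variables (n k d : nat) (r c : 'I_n -> nat).
Hypothesis rc_lt : forall i, (r i + c i < k)%N.
Hypothesis rc_inj : forall i j, r i = r j -> c i = c j -> i = j.

Local Notation G := [set: 'S_n]%G.
Local Notation aG := (regular_repr algC G).
Local Notation d1 := (delta_mx 0 (gring_index G 1) : 'rV[algC]_#|G|).

Let X := corners k d r c.
Let al := ~: X.
Let K := supp_perm_group al.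
Let R0 := label_stab_group r.
Let C0 := label_stab_group c.
Let lam := d1 *m gsum aG false R0 *m gsum aG true C0.
Let Ral := (R0 :&: K)%G.
Let Cal := (C0 :&: K)%G.

Variables (rm cm : 'I_n -> nat) (v : 'rV[algC]_#|G|).
Hypothesis rm0 : forall i, (rm i == 0%N) = (i \in al).
Hypothesis cm_inj : {in al &, injective cm}.
Hypothesis rcm_inj : forall i j, rm i = rm j -> cm i = cm j -> i = j.
Hypothesis v_kill : forall x, x \in X ->
  kron lam v *m gsum (@rho2 n) false (supp_perm (x |: al)) = 0.
Hypothesis v_neq0 : v *m gsum aG true Cal *m gsum aG false Ral != 0.

Let Rm := label_stab_group rm.
Let Cm := label_stab_group cm.
Let w := kron lam v *m gsum (@rho2 n) false K.
Let Cn := (Cm :&: supp_perm_group (~: [set t in enum al]))%G.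
Let w' := w *m gsum (@rho2 n) false Rm *m gsum (@rho2 n) true Cn.

Lemma average_kill x : x \in X -> 
  \sum_(y in x |: al) w *m rho2 (tperm x y) = 0.
Proof.
move=> Xx; rewrite -[RHS](v_kill Xx).
have nAx : x \notin al by rewrite in_setC negbK.
rewrite (gsum_supp_perm (@rho2M n) false nAx) mulmxA mulmx_sumr.
by apply: eq_bigr => y _; rewrite /twist expr0 scale1r.
Qed.

Lemma row_stab_corners g i : g \in Rm -> (g i \in X) = (i \in X).
Proof.
by move/label_stabP=> gr; apply: negb_inj; rewrite -!in_setC -/al -!rm0 gr.
Qed.

Lemma col_stab_corners g : g \in Cn -> (forall i, cm (g i) = cm i) /\ g \in supp_perm X.
Proof.
rewrite in_setI => /andP[/label_stabP gc gs]; split=> //.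
move: gs; rewrite (_ : ~: [set t in enum al] = X) //.
by apply/setP=> i; rewrite !inE mem_enum inE negbK inE.
Qed.

Lemma projected_expand : w' = \sum_(g in Rm) \sum_(q in Cn)
  twist true q *: (w *m rho2 (g * q)%g).
Proof.
rewrite /w' -mulmxA mulmx_suml mulmx_sumr; apply: eq_bigr => g _.
rewrite mulmx_sumr mulmx_sumr; apply: eq_bigr => q _.
by rewrite [twist false g]expr0 scale1r -!scalemxAr rho2M.
Qed.

Lemma sym_sub_row_stab : K \subset Rm.
Proof.
apply/subsetP=> g Kg; apply/label_stabP=> i.
have [Ai|nAi] := boolP (i \in al); last by move/supp_permP: Kg => ->.
have Agi : g i \in al by rewrite (supp_perm_closed i Kg).
by rewrite (eqP (etrans (rm0 _) Agi)) (eqP (etrans (rm0 _) Ai)).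
Qed.

Lemma projected_inv : {in K, forall g, w' *m rho2 g = w'}.
Proof.
move=> g Kg; rewrite /w' -mulmxA gsum_comm; last 2 first.
- exact: rho2M.
- move=> q /col_stab_corners[_ Xq]; apply: (@commute_supp_perm _ X al) => //.
  by rewrite disjoints_subset setCK.
rewrite mulmxA; congr (_ *m _); rewrite -mulmxA (gsumMr (@rho2M n)).
  by rewrite [twist _ _]expr0 scale1r.
exact: (subsetP sym_sub_row_stab).
Qed.

Lemma projected_kill x : x \notin al ->
  \sum_(y in x |: al) w' *m rho2 (tperm x y) = 0.
Proof.
rewrite inE negbK => Xx; rewrite -mulmx_sumr projected_expand mulmx_suml big1 // => g Rg.
rewrite mulmx_suml big1 // => q Cq; rewrite -scalemxAl -mulmxA.
set h := (g * q)%g.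
have hX i : (h i \in X) = (i \in X).
  have [_ sq] := col_stab_corners Cq.
  by rewrite permM (supp_perm_closed _ sq) row_stab_corners.
have hVX i : (h^-1%g i \in X) = (i \in X) by rewrite -hX permKV.
have Xx' : h^-1%g x \in X by rewrite hVX.
rewrite mulmx_sumr mulmx_sumr.
suff -> : \sum_(y in x |: al) w *m (rho2 h *m rho2 (tperm x y))
  = (\sum_(y in h^-1%g x |: al) w *m rho2 (tperm (h^-1%g x) y)) *m rho2 h.
  by rewrite average_kill // mul0mx scaler0.
rewrite mulmx_suml [RHS](reindex_inj (@perm_inj _ h^-1%g)) /=.
apply: eq_big => [y|y _]; last first.
  by rewrite -mulmxA -!rho2M conjgCV tpermJ.
by rewrite !in_setU1 (inj_eq perm_inj) !in_setC hVX.
Qed.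

(** In [average_ev] only the terms with [g * q] in [K] survive.  There [q] is
    trivial, since row and column labels together separate the corners. *)
Lemma projected_neq0 : w' != 0.
Proof.
pose ev := kron (delta_mx (gring_index G 1) 0 : 'cV[algC]_#|G|)
  (1%:M : 'M[algC]_#|G|).
pose w_ev := kron (1%:M : 'M[algC]_1)
  (v *m gsum aG true Cal *m gsum aG false Ral).
have proj_ev : w' *m ev = (\sum_(g in Rm) (g \in K)%:R) *: w_ev.
  rewrite projected_expand mulmx_suml scaler_suml; apply: eq_bigr => g Rg.
  have ev_gq q : q \in Cn -> w *m rho2 (g * q)%g *m ev
      = ((g * q)%g \in K)%:R *: w_ev.
    move=> Cq; apply: (average_ev rc_lt rc_inj) => i Xi.
    have [_ sq] := col_stab_corners Cq.
    by rewrite permM (supp_perm_closed _ sq) row_stab_corners.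
  rewrite mulmx_suml (bigD1 1%g) ?group1 //= big1 ?addr0 => [|q /andP[Cq ne_q]].
    by rewrite twist1 scale1r ev_gq ?group1 // mulg1.
  rewrite -scalemxAl ev_gq //; case: (boolP (_ \in K)) => [Kgq|_]; last first.
    by rewrite scale0r scaler0.
  have [qc sq] := col_stab_corners Cq; case/eqP: ne_q; apply/permP=> i; rewrite perm1.
  have [Xi|nXi] := boolP (i \in X); last by move/supp_permP: sq; exact.
  have gq j : j \in X -> (g * q)%g j = j.
    by move=> Xj; move/supp_permP: Kgq => -> //; rewrite inE negbK.
  have gi : g i = i.
    apply: rcm_inj; first by move/label_stabP: Rg.
    by rewrite -qc -permM gq.
  by rewrite -{1}gi -permM gq.
apply: contra_neq v_neq0 => w'0.
have /eqP := proj_ev; rewrite w'0 mul0mx eq_sym scaler_eq0 => /orP[/eqP|/eqP w0].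
  rewrite (bigD1 1%g) ?group1 //= => /eqP.
  by rewrite gt_eqF // ltr_pwDl ?ltr01 // sumr_ge0 // => *; rewrite ler0n.
apply/matrixP => i j; move/matrixP: w0 => /(_ (mxvec_index 0 i) (mxvec_index 0 j)).
by rewrite kronE !mxE mul1r.
Qed.

(** The row group contains [K], so averaging over [K] first only introduces a
    positive factor. *)
Lemma symmetrizer_neq0 :
  kron lam v *m gsum (@rho2 n) false Rm *m gsum (@rho2 n) true Cm != 0.
Proof.
have := col_antisymmetrizer_neq0 (@rho21 n) (@rho2M n) (@rho2V n)
  projected_inv projected_kill cm_inj projected_neq0.
apply: contra_neq => v0.
have w0 : w *m gsum (@rho2 n) false Rm = 
   #|K|%:R *: (kron lam v *m gsum (@rho2 n) false Rm).
  rewrite /w -mulmxA (gsum_subl (@rho2M n)) -?scalemxAr //.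
  exact: sym_sub_row_stab.
rewrite /w' w0 -!scalemxAl -(mulmxA _ (gsum _ true _)).
rewrite -[gsum _ true Cn *m _](gsum_col_factors (@rho2M n) cm_inj) ?enum_uniq //.
  by rewrite v0 scaler0.
by move=> i; rewrite mem_enum.
Qed.

End Assembly.

(** * A vector of full depth *)

Section Witness.

Variables (n k d : nat) (r c : 'I_n -> nat) (pt : nat -> nat -> 'I_n).
Hypothesis rc_lt : forall i, (r i + c i < k)%N.
Hypothesis rc_inj : forall i j, r i = r j -> c i = c j -> i = j.
Hypothesis pt_r : forall a b, (a + b < k)%N -> r (pt a b) = a.
Hypothesis pt_c : forall a b, (a + b < k)%N -> c (pt a b) = b.
Hypothesis lt_dk : (d < k)%N.

Local Notation G := [set: 'S_n]%G.
Local Notation aG := (regular_repr algC G).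
Local Notation d1 := (delta_mx 0 (gring_index G 1) : 'rV[algC]_#|G|).

Let X := corners k d r c.
Let al := ~: X.
Let K := supp_perm_group al.
Let R0 := label_stab_group r.
Let C0 := label_stab_group c.
Let a0 := gsum aG false R0.
Let b0 := gsum aG true C0.
Let lam := d1 *m a0 *m b0.
Let Ral := (R0 :&: K)%G.
Let Cal := (C0 :&: K)%G.
Let b' := gsum aG true Cal.
Let a' := gsum aG false Ral.
Let row0 := [set i | r i == 0%N].

Lemma eq_oppmx m1 m2 (M : 'M[algC]_(m1, m2)) : M = - M -> M = 0.
Proof.
move/eqP; rewrite -addr_eq0 -mulr2n -scaler_nat scaler_eq0 pnatr_eq0 /=.
by move/eqP.
Qed.

(** Row 0 meets every column.  Hence every translate of [x |: row0] by the row
    group has two points in one column; their transposition changes the sign of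
    [b0] and is absorbed by the symmetrizer. *)
Lemma row_Garnir x : x \notin row0 ->
  b0 *m a0 *m \sum_(y in x |: row0) aG (tperm x y) = 0.
Proof.
move=> nx; set M := \sum_(y in _) _; pose H := supp_perm_group row0.
have sHR : H \subset R0.
  apply/subsetP=> g Hg; apply/label_stabP=> i.
  have [i0|ni0] := boolP (i \in row0); last by move/supp_permP: Hg => ->.
  have := supp_perm_closed i Hg; rewrite i0 inE => /eqP->.
  by move: i0; rewrite inE => /eqP->.
have H_neq0 : #|H|%:R != 0 :> algC by exact: neq0CG.
apply: (scalerI H_neq0); rewrite scaler0 scalemxAl scalemxAr.
rewrite -(gsum_subr (@regM n) false sHR) -!mulmxA.
have -> : gsum aG false H *m M = gsum aG false (supp_perm_group (x |: row0)).
  rewrite (gsum_supp_perm (@regM n) false nx); congr (_ *m _).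
  by apply: eq_bigr => y _; rewrite [twist _ _]expr0 scale1r.
set S := gsum _ _ (supp_perm_group _).
rewrite [a0 *m S]mulmx_suml mulmx_sumr big1 // => g Rg.
rewrite [twist _ _]expr0 scale1r.
have rz : r (g^-1%g x) = r x by rewrite -groupV in Rg; move/label_stabP: Rg.
set z := g^-1%g x in rz; pose y := pt 0 (c z).
have cz : (0 + c z < k)%N by have := rc_lt z; lia.
have ne_zy : z != y.
  by apply: contraNneq nx => zy; rewrite inE -rz zy /y pt_r.
have Cz : tperm z y \in C0 by apply: tperm_label_stab; rewrite /y pt_c.
have bS : b0 *m aG (tperm z y) = - b0.
  by rewrite (gsumMr (@regM n) true Cz) /twist odd_tperm ne_zy scaleN1r.
apply: eq_oppmx; rewrite -mulNmx -bS -mulmxA; congr (_ *m _).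
rewrite mulmxA -regM conjgC tpermJ /z permKV regM -mulmxA; congr (_ *m _).
rewrite (gsumMl (@regM n)) ?[twist _ _]expr0 ?scale1r //.
apply: tperm_supp_perm; rewrite in_setU1 ?eqxx // inE.
by move/label_stabP: Rg => ->; rewrite /y pt_r // eqxx orbT.
Qed.

Lemma kron_kill (H : {group 'S_n}) t (u u' : 'rV[algC]_#|G|) :
  t \in H -> u *m aG t = - u -> u' *m aG t = u' ->
  kron u u' *m gsum (@rho2 n) false H = 0.
Proof.
move=> Ht ut u't; apply: eq_oppmx.
have {1}-> : gsum (@rho2 n) false H = rho2 t *m gsum (@rho2 n) false H.
  by rewrite (gsumMl (@rho2M n)) // [twist _ _]expr0 scale1r.
rewrite mulmxA kronM ut u't -mulNmx; congr (_ *m _).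
by rewrite -scaleN1r kronZl scaleN1r.
Qed.

Lemma lam_col_swap i j : i != j -> c i = c j -> lam *m aG (tperm i j) = - lam.
Proof.
move=> ne_ij cij; rewrite /lam -mulmxA (gsumMr (@regM n)).
  by rewrite /twist odd_tperm ne_ij scaleN1r mulmxN.
exact: tperm_label_stab.
Qed.

Lemma lam_row_stab s : s \in R0 -> lam *m a0 *m aG s = lam *m a0.
Proof.
by move=> Rs; rewrite -mulmxA (gsumMr (@regM n)) // [twist _ _]expr0 scale1r.
Qed.

Lemma lam_sandwich_neq0 : lam *m a0 *m b' *m a' != 0.
Proof.
have := sandwich_neq0 (row_col_trivial rc_inj) (subsetIl R0 K) (subsetIl C0 K).
by rewrite !mulmxA.
Qed.

Definition corner j := pt j.+1 (k - j.+2).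
Let x := corner.

Lemma r_corner j : (j < d)%N -> r (x j) = j.+1.
Proof. by move=> lt_jd; rewrite pt_r //; lia. Qed.

Lemma c_corner j : (j < d)%N -> c (x j) = (k - j.+2)%N.
Proof. by move=> lt_jd; rewrite pt_c //; lia. Qed.

Lemma corner_in j : (j < d)%N -> x j \in X.
Proof. by move=> lt_jd; rewrite inE r_corner // c_corner //; lia. Qed.

Lemma cornerP i : i \in X -> exists2 j, (j < d)%N & i = x j.
Proof.
rewrite inE => /andP[/eqP rc_i r_i]; have lt_jd : ((r i).-1 < d)%N by lia.
exists (r i).-1 => //; apply: rc_inj; first by rewrite r_corner //; lia.
by rewrite c_corner //; lia.
Qed.

Section Positive.

Hypothesis d_gt0 : (0 < d)%N.

Definition cycle_fun i := if i \in X then x (r i %% d) else i.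

Lemma cycle_fun_inj : injective cycle_fun.
Proof.
have cX i : i \in X -> x (r i %% d) \in X by rewrite corner_in ?ltn_mod.
move=> i j; rewrite /cycle_fun.
case: ifPn => Xi; case: ifPn => Xj // eij; last 2 first.
- by case/negP: Xj; rewrite -eij cX.
- by case/negP: Xi; rewrite eij cX.
apply: (@corners_inj n k d r c rc_inj) => //.
have := congr1 r eij; rewrite !r_corner ?ltn_mod // => -[].
have /cornerP[a ltad ->] := Xi; have /cornerP[b ltbd ->] := Xj.
rewrite !r_corner //.
have mod_S m : (m < d)%N -> (m.+1 %% d = if m.+1 == d then 0 else m.+1)%N.
  move=> ltm; case: eqP => [->|ne]; first exact: modnn.
  by rewrite modn_small //; lia.
by rewrite !mod_S //; case: eqP; case: eqP; lia.
Qed.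

(** For [0 < j < d] the translate of row [j] by this cycle contains the corner
    [x j] as well as the point above it in its column. *)
Definition corner_cycle : 'S_n := perm cycle_fun_inj.
Let kap := corner_cycle.

Lemma corner_cycle_supp : kap \in supp_perm X.
Proof.
by apply/supp_permP=> i nXi; rewrite permE /cycle_fun (negPf nXi).
Qed.

Lemma corner_cycleE j : (j < d)%N -> kap (x j) = x (j.+1 %% d).
Proof. by move=> lt_jd; rewrite permE /cycle_fun corner_in // r_corner. Qed.

Lemma corner_cycle_comm g : g \in K -> commute g kap.
Proof.
move=> Kg; apply: (commute_supp_perm _ Kg corner_cycle_supp).
by rewrite disjoints_subset.
Qed.

Let e := pt 0 k.-1.
Let e' := pt 0 k.-2.
Let x' := x d.-1.

Lemma last_corner_in : x' \in X.
Proof. by apply: corner_in; lia. Qed.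

Lemma row0_al i : i \in row0 -> i \in al.
Proof. by rewrite !inE => /eqP->; rewrite ltnn andbF. Qed.

Lemma end0_row0 : e \in row0.
Proof. by rewrite inE pt_r //; lia. Qed.

Lemma end1_row0 : e' \in row0.
Proof. by rewrite inE pt_r //; lia. Qed.

Lemma end0_neq_end1 : e != e'.
Proof.
apply/eqP=> /(congr1 c); rewrite !pt_c; lia.
Qed.

Lemma last_corner_nrow0 : x' \notin row0.
Proof. by apply: contraL last_corner_in => /row0_al; rewrite inE. Qed.

(** The vector symmetric under the rows of the tableau obtained by exchanging
    the last corner with [p] and then cycling the corners. *)
Definition moved p := lam *m a0 *m aG (tperm x' p) *m aG kap.

Lemma moved_inv t s p : s \in R0 ->
  (tperm x' p * kap * t = s * (tperm x' p * kap))%g ->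
  moved p *m aG t = moved p.
Proof.
move=> Rs et; rewrite /moved -!(mulmxA (lam *m a0)) -!regM et.
by rewrite (regM s) mulmxA lam_row_stab.
Qed.

(** In the tableau of [moved p] each corner [i] shares its row with the point
    [y] above it in its column.  The transposition of [i] and [y] therefore
    fixes [moved p], whereas it changes the sign of [lam].  For the corner of
    row 1, which replaces [p] in row 0, the point above is [e']: this is why
    [p] must differ from it. *)
Lemma moved_kill i p : i \in X -> p \in row0 -> p != e' ->
  kron lam (moved p) *m gsum (@rho2 n) false (supp_perm (i |: al)) = 0.
Proof.
move=> Xi p0 ne_pe'; have [j lt_jd i_j] := cornerP Xi.
pose y := pt j (k - j.+2).
have ry : r y = j by rewrite pt_r //; lia.
have cy : c y = (k - j.+2)%N by rewrite pt_c //; lia.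
have Ay : y \in al by rewrite in_setC inE ry cy; lia.
have ne_iy : i != y by apply: contraTneq Ay => <-; rewrite in_setC Xi.
have p_neq z : z \in X -> p != z.
  by move=> Xz; apply: contraTneq (row0_al p0) => ->; rewrite in_setC Xz.
apply: (@kron_kill (supp_perm_group (i |: al)) (tperm i y)).
- by apply: tperm_supp_perm; rewrite in_setU1 ?eqxx ?Ay ?orbT.
- by apply: lam_col_swap => //; rewrite cy i_j c_corner.
have kap_y : kap y = y.
  by move/supp_permP: corner_cycle_supp => -> //; rewrite -in_setC.
have [j0|j_gt0] := posnP j.
  have kap_x' : kap x' = i.
    by rewrite i_j j0 corner_cycleE ?prednK ?modnn //; lia.
  have y_e' : y = e' by rewrite /y /e' j0 subn2.
  apply: (@moved_inv _ (tperm p e')).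
    apply: tperm_label_stab.
    by move: p0 end1_row0; rewrite !inE => /eqP-> /eqP->.
  have swap : (kap * tperm i y = tperm x' e' * kap)%g.
    by rewrite [RHS]conjgC tpermJ kap_x' -y_e' kap_y.
  rewrite -mulgA swap !mulgA; congr (_ * _)%g.
  rewrite [LHS]conjgCV tpermJ tpermV tpermL tpermD //.
  by apply: contraTneq end1_row0 => <-; exact: last_corner_nrow0.
have kap_xj : kap (x j.-1) = i.
  by rewrite corner_cycleE ?prednK ?modn_small ?i_j //; lia.
have ne_x'j : x' != x j.-1.
  by apply/eqP=> /(congr1 r); rewrite !r_corner; lia.
apply: (@moved_inv _ (tperm (x j.-1) y)).
  by apply: tperm_label_stab; rewrite ry r_corner ?prednK //; lia.
have swap : (kap * tperm i y = tperm (x j.-1) y * kap)%g.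
  by rewrite [RHS]conjgC tpermJ kap_xj kap_y.
rewrite -mulgA swap !mulgA; congr (_ * _)%g.
rewrite [LHS]conjgCV tpermJ tpermV !tpermD //.
- by apply: contraTneq Ay => <-; rewrite in_setC last_corner_in.
- by apply: contraTneq p0 => ->; rewrite inE ry -lt0n.
- by rewrite p_neq // corner_in //; lia.
Qed.

(** By the Garnir relation this is also a sum of vectors to which [moved_kill]
    applies; in the present form the first two terms cancel after applying
    [b'] and [a']. *)
Definition witness := moved e - moved e' - moved x'.

Lemma witnessE : witness = moved e + \sum_(p in row0 :\ e') moved p.
Proof.
have sum0 : \sum_(p in x' |: row0) moved p = 0.
  rewrite -mulmx_suml -mulmx_sumr /lam -!mulmxA (mulmxA b0).
  by rewrite !(mulmxA (b0 *m a0)) row_Garnir ?last_corner_nrow0 // !(mul0mx, mulmx0).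
move: sum0; rewrite big_setU1 ?last_corner_nrow0 //= (big_setD1 e') ?end1_row0 //= addrA.
move/eqP; rewrite addrC addr_eq0 => /eqP->.
by rewrite /witness opprD addrA addrAC.
Qed.

Lemma witness_kill i : i \in X ->
  kron lam witness *m gsum (@rho2 n) false (supp_perm (i |: al)) = 0.
Proof.
move=> Xi; rewrite witnessE kronDr kron_sumr mulmxDl mulmx_suml.
rewrite moved_kill ?end0_row0 ?end0_neq_end1 // add0r big1 // => p.
by rewrite in_setD1 => /andP[ne_p p0]; exact: moved_kill.
Qed.

Lemma col_stab_ends q : q \in Cal -> q e = e /\ q e' = e'.
Proof.
rewrite in_setI => /andP[/label_stabP qc Kq].
have ce : c e = k.-1 by rewrite pt_c //; lia.
have ce' : c e' = k.-2 by rewrite pt_c //; lia.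
have re : r e = 0%N by have := end0_row0; rewrite inE => /eqP.
have re' : r e' = 0%N by have := end1_row0; rewrite inE => /eqP.
split; apply: rc_inj; rewrite ?qc // ?re ?re'.
  by have := rc_lt (q e); rewrite qc ce; lia.
have := row0_al end1_row0; rewrite -(supp_perm_closed e' Kq) in_setC inE qc ce'.
by have := rc_lt (q e'); rewrite qc ce'; lia.
Qed.

Lemma gsum_corner_cycle f (H : {set 'S_n}) : H \subset K ->
  aG kap *m gsum aG f H = gsum aG f H *m aG kap.
Proof.
move=> /subsetP sHK; rewrite (gsum_comm (@regM n)) // => g Hg.
exact: corner_cycle_comm (sHK _ Hg).
Qed.

(** The transposition of [e] and [e'] exchanges [moved e] and [moved e'].  Each
    of these two points is alone in its column of [al], so the transposition
    commutes with [b'], and it is absorbed by [a']. *)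
Lemma witness_sandwich : 
  witness *m b' *m a' = - (lam *m a0 *m b' *m a' *m aG kap).
Proof.
pose t := tperm e e'.
have Kt : t \in K by apply: tperm_supp_perm; rewrite row0_al ?end0_row0 ?end1_row0.
have Rt : t \in R0.
  by apply: tperm_label_stab; move: end0_row0 end1_row0; rewrite !inE => /eqP-> /eqP->.
have moved_e' : moved e' = moved e *m aG t.
  rewrite /moved -[RHS]mulmxA -regM -(corner_cycle_comm Kt) regM mulmxA; congr (_ *m _).
  rewrite -{1}(lam_row_stab Rt) -[LHS]mulmxA -[RHS]mulmxA -!regM; congr (_ *m aG _).
  rewrite [RHS]conjgC tpermJ tpermL tpermD //.
  - by apply: contraTneq end0_row0 => ->; exact: last_corner_nrow0.
  - by apply: contraTneq end1_row0 => ->; exact: last_corner_nrow0.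
have sC : Cal \subset K by exact: subsetIr.
have sR : Ral \subset K by exact: subsetIr.
have tb : aG t *m b' = b' *m aG t.
  rewrite /b' (gsum_comm (@regM n)) // => q /col_stab_ends[qe qe'].
  by rewrite /commute [RHS]conjgC tpermJ qe qe'.
have ta : aG t *m a' = a'.
  by rewrite /a' (gsumMl (@regM n)) ?[twist _ _]expr0 ?scale1r // in_setI Rt.
rewrite /witness !mulmxBl moved_e' -!mulmxA (mulmxA (aG t)) tb -!mulmxA ta subrr.
rewrite sub0r /moved tperm1 reg1 mul1mx (mulmxA (aG kap)) gsum_corner_cycle //.
by rewrite -!mulmxA gsum_corner_cycle.
Qed.

Lemma witness_neq0 : witness *m b' *m a' != 0.
Proof.
rewrite witness_sandwich oppr_eq0; apply: contra_neq lam_sandwich_neq0 => M0.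
by rewrite -[LHS]mulmx1 -reg1 -(mulgV kap) regM mulmxA M0 mul0mx.
Qed.

End Positive.

Lemma exists_witness : exists2 Y, (Y \in group_ring algC G)%MS &
  (forall i, i \in X ->
     kron lam (lam *m Y) *m gsum (@rho2 n) false (supp_perm (i |: al)) = 0)
  /\ lam *m Y *m b' *m a' != 0.
Proof.
have [d0|d_gt0] := posnP d.
  exists a0; first exact: gsum_group_ring.
  split; last exact: lam_sandwich_neq0.
  by move=> i; rewrite inE d0 leqn0; case: (r i) => [|m]; rewrite ?andbF.
exists (a0 *m (aG (tperm (corner d.-1) (pt 0 k.-1)) - aG (tperm (corner d.-1) (pt 0 k.-2))
   - aG (tperm (corner d.-1) (corner d.-1))) *m aG (corner_cycle d_gt0)).
  rewrite !envelop_mxM ?gsum_group_ring ?envelop_mx_id ?inE //.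
  by rewrite !linearB /= !addmx_sub ?eqmx_opp ?envelop_mx_id ?inE.
rewrite (_ : lam *m _ = witness d_gt0).
  by split; [exact: witness_kill | exact: witness_neq0].
by rewrite /witness /moved -!mulmxBl -!mulmxBr !mulmxA.
Qed.

End Witness.

(** * Specht modules of the canonical tableaux *)

Section SpechtModules.

Local Notation idx n := (gring_index [set: 'S_n]%G).

Lemma young_symmetrizer_op n l m (rho : 'S_n -> 'M[algC]_m) :
  {morph rho : g h / (g * h)%g >-> g *m h} ->
  \sum_g young_symmetrizer n l 0 (idx n g) *: rho g
    = gsum rho false (row_stab n l) *m gsum rho true (col_stab n l).
Proof.
move=> rhoM; rewrite /young_symmetrizer.
transitivity (\sum_g \sum_(p in row_stab n l) \sum_(q in col_stab n l)
    ((-1) ^+ q * (g == (p * q)%g)%:R) *: rho g).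
  apply: eq_bigr => g _; rewrite summxE scaler_suml; apply: eq_bigr => p _.
  rewrite summxE scaler_suml; apply: eq_bigr => q _; rewrite !mxE eqxx /=.
  by rewrite (inj_in_eq (can_in_inj gring_indexK)) ?inE.
rewrite exchange_big mulmx_suml; apply: eq_bigr => p _.
rewrite exchange_big mulmx_sumr; apply: eq_bigr => q _.
rewrite (bigD1 (p * q)%g) //= eqxx mulr1 big1 ?addr0 => [|g /negPf->].
  by rewrite [twist false p]expr0 scale1r -scalemxAr rhoM.
by rewrite mulr0 scale0r.
Qed.

Lemma polytabloid_young n l :
  delta_mx 0 (idx n 1) *m gsum (regular_repr algC _) false (row_stab n l)
    *m gsum (regular_repr algC _) true (col_stab n l)
  = young_symmetrizer n l :> 'rV[algC]_#|[set: 'S_n]%G|.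
Proof. exact: polytabloidE. Qed.

Lemma specht_mxM n l Y : (Y \in group_ring algC [set: 'S_n]%G)%MS ->
  (young_symmetrizer n l *m Y <= specht_mx n l)%MS.
Proof.
move=> RY; apply: mxmodule_envelop RY (cyclic_mx_id _ _).
exact: cyclic_mx_module.
Qed.

Lemma gsum_relabel n m (rho : 'S_n -> 'M[algC]_m) e (T : eqType)
    (f : 'I_n -> T) (s : 'S_n) :
  {morph rho : g h / (g * h)%g >-> g *m h} ->
  rho s *m gsum rho e (label_stab f) = gsum rho e (label_stab (f \o s)) *m rho s.
Proof.
move=> rhoM; rewrite mulmx_sumr mulmx_suml (reindex_inj (conjg_inj s)) /=.
apply: eq_big => [g|g _].
  apply/label_stabP/label_stabP=> fg i /=.
    by have := fg (s i); rewrite conjgE !permM permK.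
  by have /= := fg (s^-1%g i); rewrite conjgE !permM permKV.
rewrite -scalemxAl -scalemxAr -!rhoM -conjgC /twist; congr (_ ^+ (_ && _) *: _).
by rewrite odd_permJ.
Qed.

Lemma exists_perm_initial n (A : {set 'I_n}) :
  exists s : 'S_n, forall i, (i \in A) = (s i < #|A|)%N.
Proof.
pose l := enum A ++ enum (~: A).
have ul : uniq l.
  rewrite cat_uniq !enum_uniq andbT; apply/hasPn => i.
  by rewrite !mem_enum inE.
have ml i : i \in l by rewrite mem_cat !mem_enum inE orbN.
have sl : size l = n by rewrite size_cat -!cardE cardsC card_ord.
have lt_l i : (index i l < n)%N by rewrite -[X in (_ < X)%N]sl index_mem.
have inj_f : injective (fun i => Ordinal (lt_l i)).
  by move=> i j /(congr1 val) /= /(congr1 (nth i l)); rewrite !nth_index.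
exists (perm inj_f) => i; rewrite permE /= index_cat mem_enum cardE.
case: ifP => Ai; first by rewrite index_mem mem_enum.
by rewrite ltnNge leq_addr.
Qed.

Lemma reshape_coord_inj (l : seq nat) i j :
  reshape_index l i = reshape_index l j ->
  reshape_offset l i = reshape_offset l j -> i = j.
Proof. by move=> er ec; rewrite -(reshape_indexK l i) er ec reshape_indexK. Qed.

Lemma reshape_index_eq0 m (l : seq nat) i : (i < sumn (m :: l))%N ->
  (reshape_index (m :: l) i == 0%N) = (i < m)%N.
Proof.
move=> lt_i; apply/eqP/idP => [r0|lt_im].
  have := reshape_offsetP lt_i; rewrite r0 /=.
  by rewrite -{2}(reshape_indexK (m :: l) i) r0 /flatten_index take0.
have := @flatten_indexKl (m :: l) 0 i lt_im.
by rewrite /flatten_index take0.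
Qed.

Lemma size_staircase k : size (staircase k) = k.
Proof. by rewrite size_rev size_iota. Qed.

Lemma nth_staircase k a : (a < k)%N -> nth 0%N (staircase k) a = (k - a)%N.
Proof.
move=> lt_ak; rewrite nth_rev ?size_iota // nth_iota; last by lia.
by lia.
Qed.

Lemma sumn_staircase k : sumn (staircase k) = 'C(k.+1, 2).
Proof.
rewrite /staircase sumn_rev sumnE -bin2_sum big_ltn // add0n.
by rewrite /index_iota subSS subn0.
Qed.

Lemma card_corners n k d (r c : 'I_n -> nat) (pt : nat -> nat -> 'I_n) :
  (forall i j, r i = r j -> c i = c j -> i = j) ->
  (forall a b, (a + b < k)%N -> r (pt a b) = a) ->
  (forall a b, (a + b < k)%N -> c (pt a b) = b) ->
  (d < k)%N -> #|corners k d r c| = d.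
Proof.
move=> rc_inj pt_r pt_c lt_dk.
pose f (j : 'I_d) := corner k pt j.
have f_inj : injective f.
  by move=> i j /(congr1 r); rewrite !(r_corner pt_r lt_dk) // => -[] /val_inj.
rewrite -[RHS]card_ord -(card_imset _ f_inj); apply: eq_card => i.
apply/idP/imsetP=> [/(cornerP rc_inj pt_r pt_c lt_dk)[j lt_jd ->]|[j _ ->]].
  by exists (Ordinal lt_jd).
exact: corner_in.
Qed.

(** The canonical tableau of shape [mu] is relabelled by [s], so that its first
    row becomes the complement of the corners. *)
Lemma kronecker_staircase_gt0 k d nu : sumn nu = d -> (d < k)%N ->
  0 < kronecker 'C(k.+1, 2) (staircase k) (staircase k)
        (('C(k.+1, 2) - d)%N :: nu).
Proof.
move=> snu lt_dk; set n := 'C(k.+1, 2); set mu := (n - d)%N :: nu.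
have le_kn : (k <= n)%N by rewrite /n binS bin1 leq_addl.
have smu : sumn mu = n by rewrite /= snu subnK //; lia.
pose r (i : 'I_n) := reshape_index (staircase k) i.
pose c (i : 'I_n) := reshape_offset (staircase k) i.
have n_gt0 : (0 < n)%N by lia.
pose pt a b := insubd (Ordinal n_gt0) (flatten_index (staircase k) a b).
have pt_val a b : (a + b < k)%N -> pt a b = flatten_index (staircase k) a b :> nat.
  move=> lt_ab; rewrite val_insubd ifT //.
  have := @flatten_indexP (staircase k) a b; rewrite sumn_staircase; apply.
  by rewrite nth_staircase; lia.
have rc_lt i : (r i + c i < k)%N.
  have lt_i : (i < sumn (staircase k))%N by rewrite sumn_staircase ltn_ord.
  have := reshape_indexP lt_i; have := reshape_offsetP lt_i.
  rewrite -/(r i) -/(c i) size_staircase => /[swap] lt_r.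
  by rewrite nth_staircase //; lia.
have rc_inj i j : r i = r j -> c i = c j -> i = j.
  by move=> er ec; apply: val_inj; exact: reshape_coord_inj er ec.
have pt_r a b : (a + b < k)%N -> r (pt a b) = a.
  move=> lt_ab; rewrite /r pt_val // flatten_indexKl //.
  by rewrite nth_staircase; lia.
have pt_c a b : (a + b < k)%N -> c (pt a b) = b.
  move=> lt_ab; rewrite /c pt_val // flatten_indexKr //.
  by rewrite nth_staircase; lia.
set X := corners k d r c.
have cardX : #|~: X| = (n - d)%N.
  by rewrite cardsCs setCK card_ord (card_corners rc_inj pt_r pt_c).
have [s sE] := exists_perm_initial (~: X).
pose rm i := reshape_index mu (s i); pose cm i := reshape_offset mu (s i).
have rm0 i : (rm i == 0%N) = (i \in ~: X).
  by rewrite sE cardX reshape_index_eq0 // smu.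
have rcm_inj i j : rm i = rm j -> cm i = cm j -> i = j.
  by move=> er ec; apply: (@perm_inj _ s); apply: val_inj; exact: reshape_coord_inj er ec.
have cm_inj : {in ~: X &, injective cm}.
  move=> i j; rewrite -!rm0 => /eqP ri /eqP rj; apply: rcm_inj.
  by rewrite ri rj.
have [Y RY [killY neqY]] := exists_witness rc_lt rc_inj pt_r pt_c lt_dk.
have := symmetrizer_neq0 rc_lt rc_inj rm0 cm_inj rcm_inj killY neqY.
set lam := _ *m gsum _ true _ => nz.
have lamE : lam = young_symmetrizer n (staircase k) by exact: polytabloid_young.
pose aG := regular_repr algC [set: 'S_n]%G.
apply: (@kronecker_gt0 n _ _ _ (lam *m aG s) (lam *m (Y *m aG s))).
- by rewrite lamE specht_mxM // envelop_mx_id ?inE.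
- by rewrite lamE specht_mxM // envelop_mxM // envelop_mx_id ?inE.
rewrite (young_symmetrizer_op _ (@rho2M n)) (mulmxA lam) -kronM -/(rho2 s).
apply: contra_neq nz => v0.
have rowE : rho2 s *m gsum (@rho2 n) false (row_stab n mu)
    = gsum (@rho2 n) false (label_stab rm) *m rho2 s.
  exact: (gsum_relabel false (fun i : 'I_n => reshape_index mu i) s (@rho2M n)).
have colE : rho2 s *m gsum (@rho2 n) true (col_stab n mu)
    = gsum (@rho2 n) true (label_stab cm) *m rho2 s.
  exact: (gsum_relabel true (fun i : 'I_n => reshape_offset mu i) s (@rho2M n)).
rewrite -[LHS]mulmx1 -(rho21 n) -(mulgV s) rho2M mulmxA.
rewrite -(mulmxA _ _ (rho2 s)) -colE mulmxA -(mulmxA _ _ (rho2 s)) -rowE.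
by rewrite mulmxA -[X in X *m _]mulmxA v0 mul0mx.
Qed.

End SpechtModules.

(** * Counting the exceptional values *)

Lemma tminE d nu (k : nat) : (tmin d nu <= k%:Z) =
  ((-1 + sqrtC (1 + 8 * (head 0%N nu + d)%:R)) / 2 <= k%:R :> algC).
Proof.
rewrite /tmin real_ceil_le_int // rpredM ?rpredD ?rpredN ?rpred1 //.
  by rewrite sqrtC_real // addr_ge0 // mulr_ge0 ?ler0n.
by rewrite rpredV realn.
Qed.

Lemma exception_bound_real d nu : exception_bound d nu \is Num.real.
Proof.
rewrite /exception_bound rpredB ?rpredM ?rpredV ?rpredD ?realn ?rpred1 //.
by rewrite sqrtC_real // addr_ge0 // mulr_ge0 ?ler0n.
Qed.

Theorem theorem8p14 (d : nat) (nu : seq nat) (hnu : is_partition d nu) :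
  exists E : seq nat,
    (size E)%:R <= Num.max 0 (exception_bound d nu) /\
    forall k : nat, (0 < k)%N -> tmin d nu <= k%:Z -> k \notin E ->
      0 < kronecker 'C(k.+1, 2) (staircase k) (staircase k)
            (('C(k.+1, 2) - d)%N :: nu).
Proof.
have /and3P[_ nu_gt0 /eqP snu] := hnu.
pose E := [seq k <- iota 1 d | tmin d nu <= k%:Z].
exists E; split; last first.
  move=> k k_gt0 le_tk; rewrite mem_filter le_tk mem_iota /= => nEk.
  by apply: kronecker_staircase_gt0 => //; lia.
rewrite comparable_le_max; last first.
  by apply: real_comparable; rewrite ?real0 ?exception_bound_real.
have [E0|[k0 Ek0]] : E = [::] \/ exists k, k \in E.
  by case: E => [|k E']; [left | right; exists k; rewrite mem_head].
  by rewrite E0 lexx.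
apply/orP; right.
have exE : exists k, k \in E by exists k0.
(* All exceptional values lie between the least one, [m], and [d]; comparing
   with the bound then only requires [t <= m] and [1 < d]. *)
move: (ex_minnP exE) => [m Em min_m] {k0 Ek0 exE}.
have le_sz : (size E <= d.+1 - m)%N.
  rewrite -(size_iota m (d.+1 - m)); apply: uniq_leq_size.
    by rewrite filter_uniq ?iota_uniq.
  move=> k Ek; have := min_m _ Ek.
  by move: Ek; rewrite mem_filter !mem_iota; lia.
move: Em; rewrite mem_filter mem_iota tminE => /andP[].
set t := _ / 2 => le_tm m_d.
have boundE : exception_bound d nu = (2 * d)%:R - 1 - t.
  by rewrite /exception_bound /t natrM; field.
have d_gt1 : (1 < d)%N.
  rewrite ltnNge; apply/negP=> le_d1; have d1 : d = 1%N by lia.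
  (* For [d = 1] the partition is (1), and [t] is larger than 1. *)
  have head1 : head 0%N nu = 1%N.
    move: nu_gt0 snu; rewrite d1; case: (nu) => //= a l /andP[a_gt0 _]; lia.
  have m1 : m = 1%N by lia.
  move: le_tm; rewrite /t head1 d1 m1 ler_pdivrMr ?ltr0n // mul1r addrC.
  rewrite lerBlDr -[2 + 1](@sqrCK algC) ?addr_ge0 ?ler0n ?ler01 //.
  rewrite ler_sqrtC ?qualifE /= ?exprn_ge0 ?addr_ge0 ?mulr_ge0 ?ler0n ?ler01 //.
  have -> : 1 + 8 * (1 + 1)%:R = 17%:R :> algC by ring.
  have -> : (2 + 1) ^+ 2 = 9%:R :> algC by ring.
  by rewrite ler_nat.
have le_nat : ((d.+1 - m) + m + 1 <= 2 * d)%N by lia.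
rewrite boundE lerBrDr lerBrDr.
apply: le_trans (_ : (d.+1 - m + m + 1)%:R <= _); last by rewrite ler_nat.
by rewrite !natrD !lerD // ler_nat.
Qed.
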